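(* Let $l$ be a prime, let $K$ be a number field, let $r \geq 1$, let $\{(G_i,\theta_i)\}_{i\in[r]}$ be an admissible sequence of $l$-groups and let $G := G_r$. Then the map $$P_G : \mathrm{Prim}(\mathcal{S}_l^{G - \{\mathrm{id}\}}) \to \mathrm{Epi}_{\mathrm{top.gr.}}(\mathcal{G}_{K}^{\mathrm{pro}-l}, G) \cup \{\bullet\}$$ is a surjection, which restricts to a bijection between $\mathrm{Prim}(\mathcal{S}_l^{G-\{\mathrm{id}\}})(\mathrm{solv.})$ and the set of surjective continuous homomorphisms $\mathrm{Epi}_{\mathrm{top.gr.}}(\mathcal{G}_{K}^{\mathrm{pro}-l}, G)$.
   Context: **Places, characters, generators.** $G_K$ is the absolute Galois group, $\Omega_K$ the set of all places of $K$, $K^{\mathrm{pro}-l}$ the compositum of all finite Galois extensions of $K$ of $l$-power degree, $\mathcal{G}_K^{\mathrm{pro}-l} = \mathrm{Gal}(K^{\mathrm{pro}-l}/K)$. For each finite place $\mathfrak{q}$ an embedding of separable closures is fixed, giving $i_{\mathfrak{q}}^*: G_{K_{\mathfrak{q}}} \to G_K$; $I_{\mathfrak{q}}$ is the inertia subgroup of $G_{K_{\mathfrak{q}}}$ and $I_{\mathfrak{q}}(l)$ its image in $\mathcal{G}_K^{\mathrm{pro}-l}$, which is pro-cyclic if $\mathfrak{q} \nmid l$. $\mathbb{F}_l$ always has trivial Galois action, and $H^1_{\mathrm{unr}}(G_{K_{\mathfrak{q}}},\mathbb{F}_l)$ is the subgroup of unramified classes. For a set $S$ of places containing the archimedean ones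 let $\Phi_K(l,S): H^1(G_K,\mathbb{F}_l) \to \bigoplus_{\mathfrak{q}\in\Omega_K - S} H^1(G_{K_{\mathfrak{q}}},\mathbb{F}_l)/H^1_{\mathrm{unr}}(G_{K_{\mathfrak{q}}},\mathbb{F}_l)$ be the natural map. Fix a finite set $S_{\mathrm{clean}}(l)$ containing all archimedean places and all places above $l$ such that $\Phi_K(l,S_{\mathrm{clean}}(l))$ is surjective. Let $\widetilde{\Omega}_K(l)$ be the set of $\mathfrak{q} \in \Omega_K - S_{\mathrm{clean}}(l)$ with $H^1(G_{K_{\mathfrak{q}}},\mathbb{F}_l)/H^1_{\mathrm{unr}}(G_{K_{\mathfrak{q}}},\mathbb{F}_l) \neq 0$ (equivalently $\#(\mathcal{O}_K/\mathfrak{q}) \equiv 1 \bmod l$). For each $\mathfrak{q}\in\widetilde{\Omega}_K(l)$ fix $\chi_{\mathfrak{q}}\in H^1(G_K,\mathbb{F}_l)$ whose image under $\Phi_K(l,S_{\mathrm{clean}}(l))$ is non-zero exactly at the coordinate $\mathfrak{q}$. Fix a basis $J = \{\chi_1,\dots,\chi_t\}$ of $\ker \Phi_K(l,S_{\mathrm{clean}}(l))$; then $\mathcal{B}(K,l) := J \cup \{\chi_{\mathfrak{q}}\}_{\mathfrak{q}\in\widetilde{\Omega}_K(l)}$ is a basis of $H^1(G_K,\mathbb{F}_l)$. For $\mathfrak{q}\in\widetilde{\Omega}_K(l)$ fix a topological generator $\sigma_{\mathfrak{q}}$ of $I_{\mathfrak{q}}(l)$ with $\chi_{\mathfrak{q}}(\sigma_{\mathfrak{q}})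 = 1$, and complete to a minimal set of topological generators $\mathcal{B}^{\vee}(K,l) = \{\sigma_i\}_{i=1}^t \cup \{\sigma_{\mathfrak{q}}\}_{\mathfrak{q}\in\widetilde{\Omega}_K(l)}$ of $\mathcal{G}_K^{\mathrm{pro}-l}$ dual to $\mathcal{B}(K,l)$ (i.e. $\chi_i(\sigma_j)=\delta_{ij}$, $\chi_{\mathfrak{q}}(\sigma_{\mathfrak{q}'})=\delta_{\mathfrak{q}\mathfrak{q}'}$, $\chi_i(\sigma_{\mathfrak{q}}) = \chi_{\mathfrak{q}}(\sigma_i) = 0$). **Tuples.** $\mathcal{S}_l := \{0,1\}^{[t]} \times \mathcal{S}_l'$, where $\mathcal{S}_l'$ is the set of squarefree integral ideals of $\mathcal{O}_K$ supported in $\widetilde{\Omega}_K(l)$. To $(T,\mathfrak{b})\in\mathcal{S}_l$ attach $\chi_{(T,\mathfrak{b})} := \sum_{i : T_i = 1}\chi_i + \sum_{\mathfrak{q}\mid\mathfrak{b}}\chi_{\mathfrak{q}}$. Two pairs $(T,\mathfrak{b}),(T',\mathfrak{b}')$ are coprime if $\mathfrak{b},\mathfrak{b}'$ are coprime ideals and there is no $j\in[t]$ with $T_j = T'_j = 1$. For a finite set $I$, $\mathrm{Prim}(\mathcal{S}_l^{I})$ is the set of tuples in $\mathcal{S}_l^I$ with pairwise coprime coordinates. **Admissible sequences.** $\{(G_i,\theta_i)\}_{i\in[r]}$ is admissible if, with $G_0$ trivial, for each $i \in [r]$: $\theta_i : G_{i-1}^2\to\mathbb{F}_l$ is a $2$-cocycle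 (trivial action) with $\theta_i(\mathrm{id},\mathrm{id})=0$; $\theta_i$ is the zero map if and only if its class in $H^2(G_{i-1},\mathbb{F}_l)$ is trivial; and $G_i = (\mathbb{F}_l\times G_{i-1},*_{\theta_i})$ with $(a_1,g_1)*_{\theta_i}(a_2,g_2) = (a_1+a_2+\theta_i(g_1,g_2),g_1g_2)$. As a set $G=\mathbb{F}_l^{[r]}$ with identity $(0,\dots,0)$; $\pi_j(g)$ is the $\mathbb{F}_l$-entry of $g$ adjoined at step $j$. **The map $P_G$.** $\mathrm{Epi}_{\mathrm{top.gr.}}$ denotes surjective continuous homomorphisms and $\bullet$ is a formal extra symbol. For $v=(w_1,\dots,w_r)\in H^1(G_K,\mathbb{F}_l)^r$ define $\tilde{P}_G(v)$ recursively, with $\psi_0$ trivial. For $i=0,\dots,r-1$, given $\psi_i\in\mathrm{Epi}_{\mathrm{top.gr.}}(\mathcal{G}_K^{\mathrm{pro}-l},G_i)$: (1) if the class of $\psi_i^*(\theta_{i+1})$ in $H^2(G_K,\mathbb{F}_l)$ is non-trivial, $\tilde{P}_G(v)=\bullet$; (2) otherwise, if $\theta_{i+1}=0$: if $w_{i+1}$ lies in the $\mathbb{F}_l$-span of $\{w_j : j\le i,\ \theta_j=0\}$ then $\tilde{P}_G(v)=\bullet$, else $\psi_{i+1}=(w_{i+1},\psi_i)$; (3) otherwise, if $\theta_{i+1}\ne0$: let $\phi:G_K\to\mathbb{F}_l$ be the unique continuous $1$-cochain with $\phi(\sigma\tau)-\phi(\sigma)-\phi(\tau)=\theta_{i+1}(\psi_i(\sigma),\psi_i(\tau))$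 for all $\sigma,\tau$ (it factors through $\mathcal{G}_K^{\mathrm{pro}-l}$) vanishing on every element of $\mathcal{B}^{\vee}(K,l)$, and put $\psi_{i+1}=(\phi+w_{i+1},\psi_i)$, an epimorphism onto $G_{i+1}$. If $\bullet$ never occurs, $\tilde{P}_G(v):=\psi_r$. Then $P_G := \tilde{P}_G\circ\mathrm{Pow}_l([r])$ where $\mathrm{Pow}_l([r]):\mathrm{Prim}(\mathcal{S}_l^{G-\{\mathrm{id}\}})\to H^1(G_K,\mathbb{F}_l)^r$ is the bijection $(v_g)_{g}\mapsto\left(\sum_{g\ne\mathrm{id}}\pi_j(g)\chi_{v_g}\right)_{j\in[r]}$, and $\mathrm{Prim}(\mathcal{S}_l^{G-\{\mathrm{id}\}})(\mathrm{solv.}) := P_G^{-1}(\mathrm{Epi}_{\mathrm{top.gr.}}(\mathcal{G}_K^{\mathrm{pro}-l},G))$. *)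

(* Defs.v *)
From HB Require Import structures.
From mathcomp Require Import all_boot all_order all_algebra all_field.
From mathcomp Require Import boolp classical_sets functions cardinality.
From mathcomp Require Import fsbigop.

Set Implicit Arguments.
Unset Strict Implicit.
Unset Printing Implicit Defensive.

Import Order.TTheory GRing.Theory Num.Theory.
Local Open Scope classical_set_scope.
Local Open Scope ring_scope.

Section GaloisGroup.
Variables (E L : fieldType) (i : E -> L).

Record gal := Gal {
  gal_fun :> L -> L;
  gal_zmod : zmod_morphism gal_fun;
  gal_monoid : monoid_morphism gal_fun;
  gal_bij : bijective gal_fun;
  gal_fix : forall a, gal_fun (i a) = i a }.

HB.instance Definition _ := gen_eqMixin gal.
HB.instance Definition _ := gen_choiceMixin gal.

HB.instance Definition _ (s : gal) :=
  GRing.isZmodMorphism.Build L L (gal_fun s) (gal_zmod s).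
HB.instance Definition _ (s : gal) :=
  GRing.isMonoidMorphism.Build L L (gal_fun s) (gal_monoid s).

Lemma gal_ext (s t : gal) : s =1 t -> s = t.
Proof.
case: s t => [f f1 f2 f3 f4] [g g1 g2 g3 g4] /= /funext E1.
case: _ / E1 in g1 g2 g3 g4 *.
congr Gal; exact: Prop_irrelevance.
Qed.

Lemma gal_one_monoid : monoid_morphism (@id L).
Proof. by split. Qed.

Definition gal_one : gal :=
  @Gal id (fun _ _ => erefl) gal_one_monoid
    (Bijective (fun=> erefl) (fun=> erefl)) (fun=> erefl).

Section Composition.
Variables s t : gal.

Lemma gal_mul_zmod : zmod_morphism (s \o t).
Proof. by move=> x y /=; rewrite !rmorphB. Qed.

Lemma gal_mul_monoid : monoid_morphism (s \o t).
Proof. by split=> [|x y] /=; rewrite ?rmorph1 // !rmorphM. Qed.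

Lemma gal_mul_fix a : (s \o t) (i a) = i a.
Proof. by rewrite /= !gal_fix. Qed.

Definition gal_mul : gal :=
  Gal gal_mul_zmod gal_mul_monoid (bij_comp (gal_bij s) (gal_bij t)) gal_mul_fix.

End Composition.

Lemma gal_inv_key (s : gal) : {t : gal | cancel s t /\ cancel t s}.
Proof.
apply: cid; have [f fK Kf] := gal_bij s.
have fB : zmod_morphism f.
  by move=> x y; apply: (can_inj fK); rewrite Kf rmorphB /= !Kf.
have fM : monoid_morphism f.
  split=> [|x y]; apply: (can_inj fK); rewrite Kf ?rmorph1 //.
  by rewrite rmorphM /= !Kf.
have ff a : f (i a) = i a by apply: (can_inj fK); rewrite Kf gal_fix.
by exists (Gal fB fM (Bijective Kf fK) ff).
Qed.

Definition gal_inv (s : gal) : gal := sval (gal_inv_key s).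

Lemma gal_mulA : associative gal_mul.
Proof. by move=> s t u; apply: gal_ext. Qed.
Lemma gal_mul1 : left_id gal_one gal_mul.
Proof. by move=> s; apply: gal_ext. Qed.
Lemma gal_mulr1 : right_id gal_one gal_mul.
Proof. by move=> s; apply: gal_ext. Qed.
Lemma gal_mulV : left_inverse gal_one gal_inv gal_mul.
Proof.
by move=> s; apply: gal_ext => x /=; case: (svalP (gal_inv_key s)) => ->.
Qed.
Lemma gal_mulrV : right_inverse gal_one gal_inv gal_mul.
Proof.
by move=> s; apply: gal_ext => x /=; case: (svalP (gal_inv_key s)) => _ ->.
Qed.

HB.instance Definition _ :=
  isGroup.Build gal gal_mulA gal_mul1 gal_mulr1 gal_mulV gal_mulrV.

(* A basis of neighbourhoods of s in the Krull topology is given by the sets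
   of automorphisms agreeing with s on a finite list of elements of L. *)
Definition gal_near (xs : seq L) (s : gal) : set gal :=
  [set t : gal | {in xs, t =1 s}].

Definition gal_closure (A : set gal) : set gal :=
  [set s | forall xs, gal_near xs s `&` A !=set0].

(* Continuity of a map to a discrete space. *)
Definition gal_continuous (T : Type) (f : gal -> T) :=
  forall s, exists xs, forall t, gal_near xs s t -> f t = f s.

Definition gal_subgroup (H : set gal) :=
  [/\ H 1%g, forall s t, H s -> H t -> H (s * t)%g
    & forall s, H s -> H (s^-1)%g].

Definition gal_generated (A : set gal) : set gal :=
  [set s | forall H, gal_subgroup H -> A `<=` H -> H s].

Definition top_generated (A : set gal) : set gal :=
  gal_closure (gal_generated A).

Section Cohomology.
Variable l : nat.

(* With trivial action, 1-cocycles are homomorphisms and 1-coboundaries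
   vanish. *)
Definition H1 : set (gal -> 'F_l) :=
  [set f | gal_continuous f /\ {morph f : s t / (s * t)%g >-> s + t}].

Definition cobounds (phi : gal -> 'F_l) (f : gal -> gal -> 'F_l) :=
  forall s t, phi (s * t)%g - phi s - phi t = f s t.

Definition H2_trivial (f : gal -> gal -> 'F_l) :=
  exists2 phi, gal_continuous phi & cobounds phi f.

End Cohomology.

End GaloisGroup.

Section Places.
Variable K : fieldExtType rat.

Definition ring_of_integers : set K :=
  [set x | integralOver (intr : int -> K) x].

Definition integral_ideal (I : set K) :=
  [/\ I `<=` ring_of_integers, I 0, forall x y, I x -> I y -> I (x + y)
    & forall a x, ring_of_integers a -> I x -> I (a * x)].

Definition ideal_mul (I J : set K) : set K :=
  [set x | exists2 s : seq (K * K),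
     (forall p, p \in s -> I p.1 /\ J p.2) & x = \sum_(p <- s) p.1 * p.2].

Definition ideal_prod (s : seq (set K)) : set K :=
  foldr ideal_mul ring_of_integers s.

Definition ideal_exp (I : set K) n : set K := ideal_prod (nseq n I).

Definition ideal_dvd (I J : set K) :=
  exists2 M, integral_ideal M & J = ideal_mul I M.

Definition ideal_coprime (I J : set K) :=
  exists x y, [/\ I x, J y & x + y = 1].

Record finite_place := FinitePlace {
  place_ideal :> set K;
  place_integral : integral_ideal place_ideal;
  place_neq0 : exists2 x, place_ideal x & x != 0;
  place_proper : ~ place_ideal 1;
  place_prime : forall x y, ring_of_integers x -> ring_of_integers y ->
    place_ideal (x * y) -> place_ideal x \/ place_ideal y }.

HB.instance Definition _ := gen_eqMixin finite_place.
HB.instance Definition _ := gen_choiceMixin finite_place.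

(* An archimedean place is given by its absolute value x |-> |s x|, for s an
   embedding of K; two embeddings yield the same one iff they are equal or
   complex conjugate. *)
Record arch_place := ArchPlace {
  arch_abs :> K -> algC;
  arch_absP : exists s : {rmorphism K -> algC}, arch_abs = fun x => `|s x| }.

Variant place := Finite of finite_place | Arch of arch_place.

Definition squarefree_supported (A : set finite_place) (b : set K) :=
  exists s : seq finite_place,
    [/\ uniq s, forall q, q \in s -> A q
      & b = ideal_prod (map place_ideal s)].

End Places.

(* [v 0] is irrelevant: the condition v(x) >= n includes x = 0. *)
Definition val_ge (F : fieldType) (v : F -> int) (n : int) : set F :=
  [set x | x = 0 \/ n <= v x].

(* [val_emb] says that v restricts to the normalized valuation ord_q of K
   (every element of K being a quotient of two integral ones). *)
Record is_completion (K : fieldExtType rat) (q : finite_place K)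
    (F : fieldType) (c : K -> F) (v : F -> int) : Prop := IsCompletion {
  valM : forall x y, x != 0 -> y != 0 -> v (x * y) = v x + v y;
  valD : forall n x y, val_ge v n x -> val_ge v n y -> val_ge v n (x + y);
  val_emb : forall x, ring_of_integers x -> x != 0 ->
    forall n : nat, (n%:Z <= v (c x)) <-> ideal_exp q n x;
  val_dense : forall (x : F) (n : nat), exists a : K, val_ge v n%:Z (x - c a);
  val_complete : forall u : nat -> F,
    (forall n : nat, exists N, forall j k, (N <= j)%N -> (N <= k)%N ->
       val_ge v n%:Z (u j - u k)) ->
    exists x, forall n : nat, exists N, forall k, (N <= k)%N ->
       val_ge v n%:Z (u k - x) }.

(* The completion of K at q, a separable closure of it (K has characteristic
   0), and an embedding of the separable closure algC of K into the latter. *)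
Record local_data (K : fieldExtType rat) (iota : {rmorphism K -> algC})
    (q : finite_place K) := LocalData {
  loc_field : fieldType;
  loc_emb : {rmorphism K -> loc_field};
  loc_val : loc_field -> int;
  loc_completion : is_completion q loc_emb loc_val;
  loc_closure : closedFieldType;
  loc_incl : {rmorphism loc_field -> loc_closure};
  loc_algebraic : forall x, algebraicOver loc_incl x;
  loc_closure_emb : {rmorphism algC -> loc_closure};
  loc_compat : forall a, loc_closure_emb (iota a) = loc_incl (loc_emb a) }.

Section Local.
Variables (K : fieldExtType rat) (iota : {rmorphism K -> algC}).
Variables (q : finite_place K) (D : local_data iota q).

Local Notation GK := (gal iota).
Local Notation GKq := (gal (loc_incl D)).
Local Notation e := (loc_closure_emb D).

Lemma decomp_ex (s : GKq) (x : algC) : {y : algC | e y = s (e x)}.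
Proof.
apply: cid; have [p [Dp _] _] := minCpolyP x.
have [r Dr] := closed_field_poly_normal (minCpoly x).
have px0 : root (map_poly (s \o e) (minCpoly x)) ((s \o e) x).
  by rewrite fmorph_root root_minCpoly.
have eqp : map_poly (s \o e) (minCpoly x) = map_poly e (minCpoly x).
  rewrite Dp -!map_poly_comp; apply: eq_map_poly => a /=.
  by rewrite !fmorph_rat.
rewrite eqp Dr (monicP (minCpoly_monic x)) scale1r rmorph_prod /= in px0.
move: px0; rewrite (eq_bigr (fun z => 'X - (e z)%:P)); last first.
  by move=> z _; rewrite rmorphB /= map_polyX map_polyC.
rewrite -(big_map e xpredT (fun z => 'X - z%:P)) root_prod_XsubC.
by case/mapP=> y _ Dy; exists y; rewrite -Dy.
Qed.

Definition decomp_fun (s : GKq) (x : algC) : algC := sval (decomp_ex s x).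

Lemma decomp_funE s x : e (decomp_fun s x) = s (e x).
Proof. exact: svalP (decomp_ex s x). Qed.

Lemma decomp_zmod s : zmod_morphism (decomp_fun s).
Proof.
by move=> x y; apply: (fmorph_inj e); rewrite rmorphB !decomp_funE !rmorphB.
Qed.

Lemma decomp_monoid s : monoid_morphism (decomp_fun s).
Proof.
split=> [|x y]; apply: (fmorph_inj e); first by rewrite decomp_funE !rmorph1.
by rewrite rmorphM !decomp_funE !rmorphM.
Qed.

Lemma decomp_bij s : bijective (decomp_fun s).
Proof.
exists (decomp_fun s^-1%g) => x; apply: (fmorph_inj e); rewrite !decomp_funE.
  exact: (congr1 (fun t : GKq => t (e x)) (mulVg s)).
exact: (congr1 (fun t : GKq => t (e x)) (mulgV s)).
Qed.

Lemma decomp_fix s a : decomp_fun s (iota a) = iota a.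
Proof. by apply: (fmorph_inj e); rewrite decomp_funE loc_compat gal_fix. Qed.

(* The restriction map G_{K_q} -> G_K along the embedding of closures. *)
Definition decomp (s : GKq) : GK :=
  Gal (decomp_zmod s) (decomp_monoid s) (decomp_bij s) (@decomp_fix s).

Definition loc_integers : set (loc_field D) := val_ge (@loc_val _ _ _ D) 0.

Definition loc_integral : set (loc_closure D) :=
  [set x | exists p : {poly loc_field D},
     [/\ p \is monic, forall n, loc_integers p`_n
       & root (map_poly (loc_incl D) p) x]].

(* The maximal ideal (= set of nonunits) of the integral closure. *)
Definition loc_maximal : set (loc_closure D) :=
  [set x | loc_integral x /\ (x = 0 \/ ~ loc_integral x^-1)].

(* The automorphisms acting trivially on the residue field of the closure. *)
Definition inertia : set GKq :=
  [set s | forall x, loc_integral x -> loc_maximal (s x - x)].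

Definition H1_unr l : set (GKq -> 'F_l) :=
  [set f | H1 f /\ forall s, inertia s -> f s = 0].

End Local.

Arguments inertia {K iota q} D.

Section ProL.
Variables (l : nat) (K : fieldExtType rat) (iota : {rmorphism K -> algC}).

Definition galois_l_ext (A : set algC) :=
  exists (L : splittingFieldType K) (j : {rmorphism L -> algC}),
    [/\ forall a : K, j a%:A = iota a, galois 1%AS {:L}%AS,
        exists k, \dim {:L}%AS = (l ^ k)%N & A = range j].

Definition prol_set : set algC :=
  [set x | forall F : {pred algC}, divring_closed F ->
     (forall a, iota a \in F) ->
     (forall A, galois_l_ext A -> forall y, A y -> y \in F) -> x \in F].

Definition prol_pred : pred algC := fun x => `[< prol_set x >].

Lemma prol_divring : divring_closed prol_pred.
Proof.
split=> [|x y /asboolP Px /asboolP Py|x y /asboolP Px /asboolP Py];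
  apply/asboolP => F Fr Fi FA; have [F1 FB FD] := Fr => //.
  by apply: FB; [apply: Px|apply: Py].
by apply: FD; [apply: Px|apply: Py].
Qed.

HB.instance Definition _ := GRing.isDivringClosed.Build algC prol_pred
  prol_divring.

Record prol := Prol { prol_val :> algC; prol_valP : prol_pred prol_val }.

HB.instance Definition _ := [isSub for prol_val].
HB.instance Definition _ := [Choice of prol by <:].
HB.instance Definition _ := [SubChoice_isSubComUnitRing of prol by <:].
HB.instance Definition _ := [SubComUnitRing_isSubIntegralDomain of prol by <:].
HB.instance Definition _ := [SubIntegralDomain_isSubField of prol by <:].

Lemma prol_incl_subproof a : prol_pred (iota a).
Proof. by apply/asboolP => F _ Fi _. Qed.

Definition prol_incl (a : K) : prol := Prol (prol_incl_subproof a).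

Local Notation GK := (gal iota).
Local Notation GKl := (gal prol_incl).

Lemma prol_stable (s : GK) (x : algC) : prol_pred x -> prol_pred (s x).
Proof.
move=> /asboolP Px; apply/asboolP => F [F1 FB FD] Fi FA.
apply: (Px [pred y | s y \in F]).
- split; rewrite /= ?inE ?rmorph1 //.
    by move=> u v; rewrite !inE rmorphB; apply: FB.
  by move=> u v; rewrite !inE fmorph_div; apply: FD.
- by move=> a; rewrite inE gal_fix.
- move=> A [L [j [jK gL dL ->]]] y [z _ <-]; rewrite inE.
  apply: (FA (range (s \o j))); last by exists z.
  by exists L, (s \o j); split=> // a /=; rewrite jK gal_fix.
Qed.

Definition res_fun (s : GK) (x : prol) : prol := Prol (prol_stable s (valP x)).

Lemma res_zmod s : zmod_morphism (res_fun s).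
Proof. by move=> x y; apply: val_inj; rewrite /= rmorphB. Qed.

Lemma res_monoid s : monoid_morphism (res_fun s).
Proof.
by split=> [|x y]; apply: val_inj; rewrite /= ?rmorph1 ?rmorphM.
Qed.

Lemma res_bij s : bijective (res_fun s).
Proof.
exists (res_fun s^-1%g) => x; apply: val_inj => /=.
  exact: (congr1 (fun t : GK => t (val x)) (mulVg s)).
exact: (congr1 (fun t : GK => t (val x)) (mulgV s)).
Qed.

Lemma res_fix s a : res_fun s (prol_incl a) = prol_incl a.
Proof. by apply: val_inj; rewrite /= gal_fix. Qed.

Definition res (s : GK) : GKl :=
  Gal (res_zmod s) (res_monoid s) (res_bij s) (@res_fix s).

(* [res] is surjective, so the default value 1 is never used. *)
Definition lift (s : GKl) : GK := xget 1%g [set t | res t = s].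

(* The function induced on the pro-l quotient by a function on G_K that
   factors through it. *)
Definition descend (T : Type) (f : GK -> T) (s : GKl) : T := f (lift s).

End ProL.

Section Ramification.
Variables (l : nat) (K : fieldExtType rat) (iota : {rmorphism K -> algC}).
Variable D : forall q : finite_place K, local_data iota q.

Local Notation GK := (gal iota).
Local Notation GKl := (gal (prol_incl l iota)).

Definition loc_res (q : finite_place K) (chi : GK -> 'F_l) :
  gal (loc_incl (D q)) -> 'F_l := chi \o @decomp _ _ _ (D q).

Definition inertia_l (q : finite_place K) : set GKl :=
  [set res l (decomp s) | s in inertia (D q)].

(* An element of the direct sum of the H^1/H^1_unr is represented by a family
   of cocycles, almost all of them unramified. *)
Definition Phi_surjective (S : set (place K)) :=
  forall c : forall q, gal (loc_incl (D q)) -> 'F_l,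
    (forall q, ~ S (Finite q) -> H1 (c q)) ->
    finite_set [set q | ~ S (Finite q) /\ ~ H1_unr (c q)] ->
  exists2 chi : GK -> 'F_l, H1 chi &
    forall q, ~ S (Finite q) -> H1_unr (loc_res (q := q) chi - c q).

Definition ker_Phi (S : set (place K)) : set (GK -> 'F_l) :=
  [set chi | H1 chi /\
     forall q, ~ S (Finite q) -> H1_unr (loc_res (q := q) chi)].

Definition ramifiable (S : set (place K)) : set (finite_place K) :=
  [set q | ~ S (Finite q) /\
     exists2 c : gal (loc_incl (D q)) -> 'F_l, H1 c & ~ H1_unr c].

Definition is_basis (t : nat) (chi : 'I_t -> GK -> 'F_l)
    (V : set (GK -> 'F_l)) :=
  [/\ forall i, V (chi i),
      forall a : 'I_t -> 'F_l,
        \sum_i (a i \*o chi i) = 0 -> forall i, a i = 0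
    & forall f, V f -> exists a : 'I_t -> 'F_l, f = \sum_i (a i \*o chi i)].

(* The choices of S_clean(l), of the basis B(K,l) and of the dual generators;
   [chi_ram] and [sigma_ram] only matter on [ramifiable clean]. *)
Record generator_data := GeneratorData {
  clean : set (place K);
  clean_finite : finite_set clean;
  clean_arch : forall v, clean (Arch v);
  clean_above_l : forall q : finite_place K, place_ideal q l%:R -> clean (Finite q);
  clean_surj : Phi_surjective clean;
  chi_num : nat;
  chi_ker : 'I_chi_num -> GK -> 'F_l;
  chi_ker_basis : is_basis chi_ker (ker_Phi clean);
  chi_ram : finite_place K -> GK -> 'F_l;
  chi_ramP : forall q, ramifiable clean q -> H1 (chi_ram q) /\
    forall q', ~ clean (Finite q') ->
      (~ H1_unr (loc_res (q := q') (chi_ram q)) <-> q' = q);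
  sigma_ker : 'I_chi_num -> GKl;
  sigma_ram : finite_place K -> GKl;
  sigma_ram_gen : forall q, ramifiable clean q ->
    top_generated [set sigma_ram q] = inertia_l q;
  sigma_set : set GKl := range sigma_ker `|` (sigma_ram @` ramifiable clean);
  sigma_gen : top_generated sigma_set = setT;
  sigma_min : forall A, A `<=` sigma_set -> top_generated A = setT ->
    A = sigma_set;
  dual_ker_ker : forall i j, descend (chi_ker i) (sigma_ker j) = (i == j)%:R;
  dual_ram_ram : forall q q', ramifiable clean q -> ramifiable clean q' ->
    descend (chi_ram q) (sigma_ram q') = (q == q')%:R;
  dual_ker_ram : forall i q, ramifiable clean q ->
    descend (chi_ker i) (sigma_ram q) = 0;
  dual_ram_ker : forall q j, ramifiable clean q ->
    descend (chi_ram q) (sigma_ker j) = 0 }.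

End Ramification.

Arguments chi_ker {l K iota D} g i.
Arguments chi_ram {l K iota D} g q.
Arguments sigma_ker {l K iota D} g i.
Arguments sigma_ram {l K iota D} g q.
Arguments sigma_set {l K iota D} g.
Arguments ramifiable l {K iota} D S.

Section Admissible.
Variable l : nat.

(* The carrier F_l^i of G_i; the first component of an element of
   [tower i.+1] is the entry adjoined at step i.+1. *)
Fixpoint tower (i : nat) : finType :=
  if i is j.+1 then ('F_l * tower j)%type : finType else unit : finType.

Fixpoint tower1 (i : nat) : tower i :=
  if i is j.+1 return tower i then (0, tower1 j) else tt.

(* [coord j g] is pi_{j+1}(g): indices start from 0. *)
Fixpoint coord (j i : nat) : tower i -> 'F_l :=
  if i is k.+1 return tower i -> 'F_l then
    fun g => if j == k then g.1 else coord j g.2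
  else fun=> 0.

(* [theta i] is the cochain theta_{i+1} on G_i x G_i. *)
Variable theta : forall i, tower i -> tower i -> 'F_l.

Fixpoint tower_mul (i : nat) : tower i -> tower i -> tower i :=
  if i is j.+1 return tower i -> tower i -> tower i then
    fun g h => (g.1 + h.1 + theta g.2 h.2, tower_mul g.2 h.2)
  else fun _ _ => tt.

Definition theta_zero i := [forall g : tower i, forall h, theta g h == 0].

Definition theta_cocycle i := forall g h k : tower i,
  theta g h + theta (tower_mul g h) k = theta h k + theta g (tower_mul h k).

Definition theta_trivial i := exists c : tower i -> 'F_l,
  forall g h, theta g h = c (tower_mul g h) - c g - c h.

Definition admissible (r : nat) := forall i, (i < r)%N ->
  [/\ theta_cocycle i, theta (tower1 i) (tower1 i) = 0
    & theta_zero i <-> theta_trivial i].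

End Admissible.

Section MapP.
Variables (l : nat) (K : fieldExtType rat) (iota : {rmorphism K -> algC}).
Variable D : forall q : finite_place K, local_data iota q.
Variable B : generator_data l D.
Variable theta : forall i, tower l i -> tower l i -> 'F_l.

Local Notation GK := (gal iota).
Local Notation GKl := (gal (prol_incl l iota)).

Definition Epi (r : nat) : set (GKl -> tower l r) :=
  [set psi | [/\ gal_continuous psi,
     {morph psi : s t / (s * t)%g >-> tower_mul theta s t}
     & forall g, exists s, psi s = g]].

Definition Spair : Type := ({ffun 'I_(chi_num B) -> bool} * set K)%type.

Definition Sl : set Spair :=
  [set p | squarefree_supported (ramifiable l D (clean B)) p.2].

Definition chi_pair (p : Spair) : GK -> 'F_l :=
  \sum_(i | p.1 i) chi_ker B i +
  \sum_(q \in [set q : finite_place K | ideal_dvd q p.2]) chi_ram B q.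

Definition pair_coprime (p p' : Spair) :=
  ideal_coprime p.2 p'.2 /\ ~ exists j, p.1 j /\ p'.1 j.

Definition non_id (r : nat) := {g : tower l r | g != tower1 l r}.

Definition Prim (r : nat) : set (non_id r -> Spair) :=
  [set v | (forall g, Sl (v g)) /\
           (forall g h, g != h -> pair_coprime (v g) (v h))].

Definition Pow (r : nat) (v : non_id r -> Spair) (j : nat) : GK -> 'F_l :=
  \sum_(g : non_id r) (coord j (val g) \*o chi_pair (v g)).

Definition in_span (w : nat -> GK -> 'F_l) (i : nat) :=
  exists a : nat -> 'F_l,
    w i = \sum_(j < i | theta_zero theta j) (a j \*o w j).

Definition pullback i (psi : GKl -> tower l i) (s t : GK) : 'F_l :=
  theta (psi (res l s)) (psi (res l t)).

(* The unique such cochain whenever the class of [pullback psi] is trivial;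
   the default value 0 is used only in the other case. *)
Definition normalized_cochain i (psi : GKl -> tower l i) : GK -> 'F_l :=
  xget 0 [set phi | [/\ gal_continuous phi, cobounds phi (pullback psi)
    & forall s, sigma_set B s -> descend phi s = 0]].

(* [None] is the extra symbol; [w j] is the character w_{j+1}. *)
Fixpoint Ptilde (w : nat -> GK -> 'F_l) (i : nat) :
    option (GKl -> tower l i) :=
  if i is j.+1 return option (GKl -> tower l i) then
    if Ptilde w j is Some psi then
      if `[< ~ H2_trivial (pullback psi) >] then None
      else if theta_zero theta j then
        if `[< in_span w j >] then None
        else Some (fun s => (descend (w j) s, psi s))
      else Some (fun s => (descend (normalized_cochain psi + w j) s, psi s))
    else None
  else Some (fun=> tt).

Definition PG (r : nat) (v : non_id r -> Spair) : option (GKl -> tower l r) :=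
  Ptilde (Pow v) r.

Definition Prim_solv (r : nat) : set (non_id r -> Spair) :=
  @Prim r `&` @PG r @^-1` (Some @` @Epi r).

End MapP.

Arguments Epi {l K} iota theta r.
Arguments Prim {l K iota D} B r.
Arguments PG {l K iota D} B theta r.
Arguments Prim_solv {l K iota D} B theta r.

(* Main.v *)
Require Import Defs.
From HB Require Import structures.
From mathcomp Require Import all_boot all_order all_algebra all_fingroup.
From mathcomp Require Import all_solvable all_field.
From mathcomp Require Import boolp classical_sets functions cardinality filter.
From mathcomp Require Import fsbigop ring.

(** An epimorphism psi from the pro-l quotient to G is built one coordinate at a
    time. Suppose psi_i onto G_i is known and the pullback of theta_(i+1) is
    trivial. The lifts of psi_i to G_(i+1) are the pairs (phi + w, psi_i), where
    phi is a fixed cochain trivializing the pullback and w runs through the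
    characters, so psi_(i+1) and w_(i+1) determine each other ([Ptilde_inj],
    [Ptilde_surj]). A lift can fail to be onto only if its last coordinate is a
    function on G_i ([surj_or_graph]). For a nontrivial cocycle this would split the
    extension, and for the zero cocycle it means that w_(i+1) lies in the span of
    the characters used at the split steps ([tower_hom_span]), the case in which the
    construction answers with the extra symbol ([Ptilde_Epi]). The extra symbol is
    attained by w = 0, since the first cocycle is zero ([Ptilde0_None]).

    The r-tuples of characters correspond to primitive tuples because a character
    is determined by its values at the generators sigma ([H1_ext]), and these values can be prescribed freely as long as almost all are
    zero ([prescribed_character]). At sigma_t the values of w_1, ..., w_r are the
    coordinates of an element of G, and v_g collects the indices t at which this
    element is g ([Pow_sigma], [Pow_inj], [Pow_surj]). Products of distinct primes
    are handled as finite sets of places, which rests on the maximality of nonzero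
    primes ([place_maximal]).

    Two facts on Galois groups support this. First, a continuous function that is
    constant on the cosets of an open normal subgroup, with a quotient of l-power
    exponent, factors through the pro-l quotient ([open_normal_prol]), and every
    automorphism of the pro-l closure lifts to G_K ([res_surj]). This applies to
    characters and to the cochains phi. Second, a continuous function on G_K is
    constant on inertia at almost all primes: for a single algebraic number x the
    primes whose inertia moves x contain one of finitely many nonzero integers
    ([almost_unramified]), and finitely many primes contain a given nonzero integer
    ([finite_places_above]). *)

Set Implicit Arguments.
Unset Strict Implicit.
Unset Printing Implicit Defensive.
Import Order.TTheory GRing.Theory Num.Theory.
Local Open Scope classical_set_scope.
Local Open Scope ring_scope.

(** * Number fields inside the algebraic numbers *)

Local Notation pQtoC := (map_poly (ratr : rat -> algC)).

Section Splitting.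
Variables (K : fieldExtType rat) (iota : {rmorphism K -> algC}).

(** A nonzero polynomial over K of least degree vanishing at z is irreducible. *)
Lemma irreducible_root_over (z : algC) :
  exists2 p : {poly K}, irreducible_poly p & root (map_poly iota p) z.
Proof.
have [q [Dq mq] _] := minCpolyP z.
pose P n := `[< exists p : {poly K},
  [/\ p != 0, root (map_poly iota p) z & size p = n] >].
have [|n /asboolP[p [p0 pz Dn]] n_min] := @ex_minnP P.
  exists (size (map_poly (in_alg K) q)); apply/asboolP.
  exists (map_poly (in_alg K) q); split=> //.
    by rewrite map_poly_eq0 monic_neq0.
  rewrite -map_poly_comp (eq_map_poly (_ : _ =1 ratr)) => [|b /=].
    by rewrite -Dq root_minCpoly.
  by rewrite alg_num_field fmorph_rat.
exists p => //; apply/(subfx_irreducibleP pz p0) => r rz r0.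
by rewrite Dn n_min //; apply/asboolP; exists r.
Qed.

(** By the primitive element theorem the rational conjugates of the xs generate a
    field Q(z). As K(z) is generated over K by all the roots of a polynomial with
    rational coefficients, it is normal over K. *)
Lemma splitting_field_in_algC (xs : seq algC) :
  exists (L : splittingFieldType K) (j : {rmorphism L -> algC}),
    (forall a : K, j a%:A = iota a) /\
    (forall x, x \in xs -> exists y, j y = x).
Proof.
have /all_sig[r Dr] (x : algC) : {r | pQtoC r = minCpoly x & r \is monic}.
  by have [r [-> mr] _] := minCpolyP x; exists r.
pose P : {poly rat} := \prod_(x <- xs) r x.
have mP : pQtoC P \is monic.
  by rewrite map_monic; apply: monic_prod => x _; have [_] := Dr x.
have [rs Drs] := closed_field_poly_normal (pQtoC P).
rewrite (monicP mP) scale1r in Drs.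
have [z [a Dz] [ps Dps]] := algC_PET rs.
(* z is an integral combination of the conjugates rs, each of which is a
   rational polynomial in z. *)
have [p irr_p pz] := irreducible_root_over z.
have [L0 [j [z0 [jK jz z0gen]]]] : exists (L0 : fieldExtType K)
    (j : {rmorphism L0 -> algC}) (z0 : L0),
    [/\ forall b : K, j b%:A = iota b, j z0 = z
      & forall x, exists q, x = (map_poly (in_alg L0) q).[z0]].
  have p0 := irredp_neq0 irr_p.
  exists (SubFieldExtType pz irr_p), (@subfx_inj _ _ iota z p).
  exists (subfx_root iota z p); split.
  - exact: subfx_inj_base.
  - exact: subfx_inj_root.
  - by move=> x; have [q ->] := subfxEroot pz p0 x; exists q.
pose iQ : {rmorphism rat -> L0} := in_alg L0 \o in_alg K.
have jQ (q : {poly rat}) : map_poly j (map_poly iQ q) = pQtoC q.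
  rewrite -map_poly_comp; apply: eq_map_poly => b /=.
  by rewrite jK alg_num_field fmorph_rat.
pose s := [seq (map_poly iQ q).[z0] | q <- ps].
have Ds : map j s = rs.
  rewrite Dps -map_comp; apply: eq_map => q /=.
  by rewrite -horner_map /= jz jQ.
have split0 : SplittingField.axiom L0.
  exists (map_poly iQ P).
    apply/polyOverP => i; rewrite coef_map /=; exact: rpredZ (mem1v _).
  exists s.
    suff -> : map_poly iQ P = \prod_(x <- s) ('X - x%:P) by exact: eqpxx.
    apply: (map_poly_inj j); rewrite jQ Drs -Ds big_map rmorph_prod /=.
    by apply: eq_bigr => x _; rewrite map_polyXsubC.
  have sz : size s = size rs by rewrite -Ds (size_map j).
  have z0s : z0 \in <<1 & s>>%VS.
    suffices -> : z0 = \sum_(i < size rs) s`_i *+ a i.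
      by rewrite memv_suml // => i _; rewrite rpredMn ?seqv_sub_adjoin ?mem_nth ?sz.
    apply: (fmorph_inj j); rewrite jz Dz rmorph_sum; apply: eq_bigr => i _.
    by rewrite rmorphMn /= -(nth_map 0 (0 : algC)) ?sz // Ds.
  apply/vspaceP=> x; rewrite memvf; have [q ->] := z0gen x.
  rewrite horner_coef.
  apply: rpred_sum => i _; rewrite coef_map /= -scalerAl mul1r.
  by apply: rpredZ; apply: rpredX.
pose L : splittingFieldType K :=
  HB.pack L0 (FieldExt_isSplittingField.Build K L0 split0).
exists L, j; split=> // x xs_x.
have : x \in rs.
  rewrite -root_prod_XsubC -Drs /P (big_rem x) //= rmorphM /= rootM.
  by have [-> _] := Dr x; rewrite root_minCpoly.
by rewrite -Ds => /mapP[y _ ->]; exists y.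
Qed.

End Splitting.

(** A Galois subfield E is generated over F by the roots of a separable polynomial,
    all of which lie in E; hence it is a splitting field in its own right. *)
Lemma galois_subfield_splitting (F : fieldType) (L : splittingFieldType F)
    (E : {subfield L}) : galois 1%AS E ->
  exists (L2 : splittingFieldType F) (v : {rmorphism L2 -> L}),
    [/\ forall a : F, v a%:A = a%:A, galois 1%AS {:L2}%AS,
        \dim {:L2}%AS = \dim E
      & forall y, y \in E -> exists x, v x = y].
Proof.
move=> /splitting_galoisField[p [p1 sep_p [rs Dp defE]]].
have rsE : {subset rs <= E}.
  by move=> x xrs; rewrite -defE seqv_sub_adjoin.
pose w : 'Hom(subvs_of E, L) := linfun vsval.
have wE : w =1 vsval by move=> x; rewrite lfunE.
have w_ahom : ahom_in {:subvs_of E} w.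
  apply/ahom_inP; split=> [x y _ _|]; rewrite !wE ?rmorphM ?rmorph1 //.
pose f : 'AHom(subvs_of E, L) := AHom w_ahom.
have fE : f =1 vsval by exact: wE.
have fL0 : lker f == 0%VS by apply/lker0P=> x y; rewrite !fE; apply: val_inj.
have imf : (f @: fullv = E)%VS.
  apply/vspaceP=> x; apply/memv_imgP/idP => [[y _ ->]|xE].
    by rewrite fE subvsP.
  by exists (vsproj E x); rewrite ?memvf // fE vsprojK.
have /all_sig[g gE] (x : L) : {y : subvs_of E | x \in E -> vsval y = x}.
  by exists (vsproj E x) => /vsprojK.
pose rs2 := map g rs.
have Drs2 : map vsval rs2 = rs.
  rewrite -map_comp -[RHS]map_id; apply/eq_in_map => x xrs /=.
  by rewrite gE ?rsE.
pose p2 := \prod_(x <- rs2) ('X - x%:P).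
have Dp2 : map_poly vsval p2 = \prod_(x <- rs) ('X - x%:P).
  rewrite -Drs2 big_map rmorph_prod /=; apply: eq_bigr => x _.
  by rewrite map_polyXsubC.
have P1 : \prod_(x <- rs) ('X - x%:P) \is a polyOver 1%VS.
  have := eqp_eq Dp; rewrite (monicP (monic_prod_XsubC _ _ _)) scale1r => Ep.
  have c0 : lead_coef p != 0.
    by rewrite lead_coef_eq0 separable_poly_neq0.
  apply/polyOverP=> i; move/polyOverP: p1 => p1.
  have := congr1 (fun q : {poly L} => q`_i) Ep; rewrite coefZ => Ei.
  have -> : (\prod_(x <- rs) ('X - x%:P))`_i = (lead_coef p)^-1 * p`_i.
    by rewrite Ei mulKf.
  exact: rpredM (rpredVr (p1 _)) (p1 _).
have p2_1 : p2 \is a polyOver 1%VS.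
  apply/polyOverP=> i; have /polyOverP/(_ i) := P1.
  rewrite -Dp2 coef_map => /vlineP[a Ea]; apply/vlineP; exists a.
  by apply: val_inj; rewrite Ea /= algid1.
have split2 : splittingFieldFor 1 p2 {:subvs_of E}.
  exists rs2; first exact: eqpxx.
  apply/eqP; rewrite eqEsubv subvf /= -(limg_ker0 _ _ fL0) imf.
  rewrite aimg_adjoin_seq (eq_map fE) Drs2 aimg1.
  by rewrite defE subvv.
pose L2 : splittingFieldType F :=
  HB.pack (subvs_of E) (FieldExt_isSplittingField.Build F (subvs_of E)
    (ex_intro2 _ _ p2 p2_1 split2)).
exists L2, vsval; split.
- by move=> a; rewrite /= algid1.
- apply/splitting_galoisField; exists p2; split=> //.
  rewrite -(separable_map vsval) Dp2.
  by rewrite -(eqp_separable Dp).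
- rewrite -imf limg_dim_eq //.
  by rewrite (eqP fL0) capv0.
- by move=> y yE; exists (vsproj E y); exact: vsprojK.
Qed.

Section Lifts.
Variables (K : fieldExtType rat) (iota : {rmorphism K -> algC}).
Variables (L : splittingFieldType K) (j : {rmorphism L -> algC}).
Hypothesis jK : forall a : K, j a%:A = iota a.
Local Notation GK := (Defs.gal iota).

(** Extension of automorphisms from a number field to the algebraic numbers, with L
    viewed as a number field over Q. *)
Lemma gal_lift (g : gal_of {:L}) : exists s : GK, forall x, s (j x) = j (g x).
Proof.
pose LQ : fieldExtType rat := baseFieldType L.
pose g' : {rmorphism LQ -> LQ} := (gal_repr g : {rmorphism L -> L}).
pose j' : {rmorphism LQ -> algC} := j.
have [nu Dnu] := extend_algC_subfield_aut j' g'.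
have nu_fix a : nu (iota a) = iota a.
  rewrite -jK; have <- := Dnu a%:A; congr (j _).
  by rewrite /g' /= linearZ /= rmorph1.
have nu_bij : bijective nu by exists (algC_invaut nu); [apply: algC_autK|apply: algC_invautK].
exists (Defs.Gal (rmorphB nu) (conj (rmorph1 nu) (rmorphM nu)) nu_bij nu_fix) => x /=.
by have <- := Dnu x.
Qed.

Lemma ext_pchar0 : [pchar L] =i pred0.
Proof.
by move=> p; rewrite (pchar_lalg L) (pchar_lalg K) pchar_num.
Qed.

Lemma galois_full : galois 1%AS {:L}%AS.
Proof.
rewrite /galois sub1v normalFieldf andbT /=.
by apply/separableP=> x _; apply: pcharf0_separable ext_pchar0 _.
Qed.

Lemma map_minPoly_base (x : L) : exists2 p : {poly K}, minPoly 1 x = map_poly (in_alg L) p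
   & forall s : GK, map_poly (s \o j) (minPoly 1 x) = map_poly j (minPoly 1 x).
Proof.
have /polyOver1P[p Dp] := minPolyOver 1 x; exists p; first exact: Dp.
move=> s; rewrite Dp -!map_poly_comp; apply: eq_map_poly => a /=.
by rewrite jK gal_fix.
Qed.

(** L has a primitive element, and s permutes the roots of its minimal polynomial,
    all of which lie in L. *)
Lemma gal_restrict (s : GK) :
  exists2 g : gal_of {:L}, g \in 'Gal({:L} / 1)%g & forall x, s (j x) = j (g x).
Proof.
have /and3P[_ sepL nL] := galois_full.
have DL := eq_adjoin_separable_generator sepL (sub1v _).
set z := separable_generator _ _ in DL.
have [p Dp sp] := map_minPoly_base z.
have [r _ Dr] := normalFieldP nL z (memvf _).
have : root (map_poly j (minPoly 1 z)) (s (j z)).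
  rewrite -(sp s); have -> : s (j z) = (s \o j) z by [].
  by rewrite fmorph_root root_minPoly.
rewrite Dr rmorph_prod (eq_bigr (fun b => 'X - (j b)%:P)) /=; last first.
  by move=> b _; rewrite map_polyXsubC.
rewrite -(big_map j xpredT (fun b => 'X - b%:P)) root_prod_XsubC.
case/mapP => b br Db.
have [|g gG gz] := normalField_root_minPoly (sub1v {:L}%AS) nL (memvf z) (b := b).
  by rewrite Dr root_prod_XsubC.
exists g => // x; have : x \in {:L}%VS by rewrite memvf.
rewrite {1}DL => /Fadjoin_polyP[q /polyOver1P[q' ->] ->].
set P := map_poly _ q'.
have e1 : map_poly (s \o j) P = map_poly iota q'.
  by rewrite -map_poly_comp; apply: eq_map_poly => a /=; rewrite jK gal_fix.
have e2 : map_poly (j \o g) P = map_poly iota q'.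
  rewrite -map_poly_comp; apply: eq_map_poly => a /=.
  by rewrite linearZ /= rmorph1 jK.
have := horner_map (s \o j) P z; rewrite e1 /= Db => <-.
by have := horner_map (j \o g) P z; rewrite e2 /= gz => <-.
Qed.

End Lifts.

(** * Open normal subgroups with a quotient of l-power exponent *)

Lemma mem_gal_full (F : fieldType) (L : splittingFieldType F) (g : gal_of {:L}) :
  g \in 'Gal({:L} / 1)%g.
Proof.
rewrite gal_kHom ?sub1v //; apply/kAHomP=> _ /vlineP[a ->].
by rewrite linearZ /= rmorph1.
Qed.

Section OpenNormal.
Variables (l : nat) (K : fieldExtType rat) (iota : {rmorphism K -> algC}).
Hypothesis l_pr : prime l.
Local Notation GK := (Defs.gal iota).

(** The bridge between open normal subgroups of G_K and the pro-l closure. Some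
    finite Galois extension L of K contains the xs, so N is the preimage of a
    normal subgroup of Gal(L/K). The quotient has exponent dividing l^k, hence is
    an l-group, so the fixed field E of that subgroup is a Galois extension of K of
    l-power degree and lies in the pro-l closure. The ys are a basis of E over K. *)
Lemma open_normal_prol (N : set GK) (xs : seq algC) k :
    gal_subgroup N -> (forall s t, N s -> N (t * s * t^-1)%g) ->
    (forall s : GK, {in xs, forall x, s x = x} -> N s) ->
    (forall s, N (s ^+ (l ^ k))%g) ->
  exists ys : seq (prol l iota),
    forall s : GK, {in ys, forall y : prol l iota, s (val y) = val y} -> N s.
Proof.
move=> [N1 NM NV] NJ Nxs NX.
have [L [j [jK xsL]]] := splitting_field_in_algC iota xs.
pose above (s : GK) (g : gal_of {:L}) := forall x, s (j x) = j (g x).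
have aboveM s t g h : above s g -> above t h -> above (t * s)%g (g * h)%g.
  by move=> sg th x; rewrite galM ?memvf //= -th -sg.
have above1 : above 1%g 1%g by move=> x; rewrite gal_id.
(* Composition of automorphisms and the product of Galois groups are in
   opposite orders. *)
pose Nb := [set g : gal_of {:L} | `[< exists2 s, N s & above s g >]]%SET.
have NbP g : reflect (exists2 s, N s & above s g) (g \in Nb).
  by rewrite inE; apply: asboolP.
have gNb : group_set Nb.
  apply/group_setP; split; first by apply/NbP; exists 1%g.
  move=> g h /NbP[s Ns sg] /NbP[t Nt th]; apply/NbP; exists (t * s)%g; first exact: NM.
  exact: aboveM.
pose NG := Group gNb; pose G := 'Gal({:L} / 1)%G.
have aboveV s g : above s g -> above s^-1%g g^-1%g.
  move=> sg x; apply: (fmorph_inj s); transitivity (j x).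
    exact: (congr1 (fun t : GK => t (j x)) (mulgV s)).
  by rewrite [RHS]sg -galM ?memvf // mulVg gal_id.
have nNG : (NG <| G)%g.
  apply/andP; split; first by apply/fintype.subsetP=> g _; apply: mem_gal_full.
  apply/fintype.subsetP=> x _; rewrite inE; apply/fintype.subsetP=> _ /imsetP[g /NbP[s Ns sg] ->].
  have [t tx] := gal_lift jK x; apply/NbP; exists (t * s * t^-1)%g; first exact: NJ.
  have -> : (t * s * t^-1 = t * (s * t^-1))%g by rewrite mulgA.
  have -> : (g ^ x = x^-1 * g * x)%g by rewrite conjgE mulgA.
  by apply: (aboveM) => //; apply: (aboveM) => //; apply: (aboveV).
have galL := galois_full L.
have galE := normal_fixedField_galois galL nNG.
pose E : {subfield L} := [aspace of fixedField NG].
have GE : ('Gal({:L} / E) = NG)%g by rewrite gal_fixedField.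
have lG : (l.-group (G / NG))%g.
  rewrite -pnat_exponent; apply: (@pnat_dvd _ (l ^ k)%N); last by rewrite pnatX pnat_id.
  apply/exponentP=> _ /morphimP[g nNg _ ->].
  rewrite -morphX //; apply: coset_id.
  have [s sg] := gal_lift jK g; apply/NbP; exists (s ^+ (l ^ k))%g => //.
  elim: (l ^ k)%N => [|n IHn]; first by rewrite !expg0.
  by rewrite expgSr expgS; apply: aboveM.
have dimE : exists k', \dim E = (l ^ k')%N.
  have := card_pgroup lG; rewrite -GE.
  have sE : (1%AS <= E <= {:L}%AS)%VS by rewrite sub1v subvf.
  have /and3P[_ _ nE] := galE.
  rewrite (card_isog (normalField_isog galL sE nE)) -(galois_dim galE) dimv1 divn1.
  by move=> ->; eexists.
have [L2 [v [vK gal2 dim2 vE]]] := galois_subfield_splitting galE.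
have jv_prol x : prol_pred l iota (j (v x)).
  apply/asboolP=> F Fr Fi FA; apply: (FA (range (j \o v))); last by exists x.
  exists L2, (j \o v); split=> //=; first by move=> a; rewrite vK jK.
  by have [k' Dk'] := dimE; exists k'; rewrite dim2 Dk'.
exists [seq Prol (jv_prol x) | x <- vbasis {:L2}] => s sY.
have sj x : s (j (v x)) = j (v x).
  rewrite (coord_vbasis (memvf x)) !rmorph_sum; apply: eq_bigr => i _ /=.
  rewrite -mulr_algl !rmorphM /= vK jK gal_fix.
  congr (_ * _); have bi : (vbasis {:L2})`_i \in vbasis {:L2}.
    by rewrite mem_nth // size_tuple.
  exact: (sY (Prol (jv_prol _)) (map_f _ bi)).
have [g _ sg] := gal_restrict jK s.
have /NbP[t Nt tg] : g \in NG.
  rewrite -GE gal_kHom ?subvf //; apply/kAHomP=> y /vE[x <-].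
  by apply: (fmorph_inj j); rewrite -sg sj.
rewrite -[s](mulKVg t); apply: NM => //; apply: Nxs => _ /xsL[x <-] /=.
apply: (fmorph_inj t); rewrite [LHS](congr1 (fun u : GK => u (s (j x))) (mulgV t)).
by rewrite /= sg tg.
Qed.

End OpenNormal.

(** * Lifting automorphisms of the pro-l closure *)

Section ResSurjective.
Variables (l : nat) (K : fieldExtType rat) (iota : {rmorphism K -> algC}).
Local Notation GK := (Defs.gal iota).
Local Notation P := (prol l iota).
Local Notation GKl := (Defs.gal (prol_incl l iota)).

Lemma prol_incl_zmod : zmod_morphism (@prol_incl l K iota).
Proof. by move=> x y; apply: val_inj; rewrite /= rmorphB. Qed.
Lemma prol_incl_monoid : monoid_morphism (@prol_incl l K iota).
Proof. by split=> [|x y]; apply: val_inj; rewrite /= ?rmorph1 ?rmorphM. Qed.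
HB.instance Definition _ := GRing.isZmodMorphism.Build K P (@prol_incl l K iota) prol_incl_zmod.
HB.instance Definition _ := GRing.isMonoidMorphism.Build K P (@prol_incl l K iota) prol_incl_monoid.

Lemma prol_adjoin_seq (L : splittingFieldType K) (j : {rmorphism L -> algC})
    (rs : seq L) :
    (forall a : K, j a%:A = iota a) ->
    (forall x, x \in rs -> j x \in prol_pred l iota) ->
  forall x, x \in <<1 & rs>>%VS -> j x \in prol_pred l iota.
Proof.
move=> jK; elim/last_ind: rs => [|rs y IH] rsP x.
  by rewrite Fadjoin_nil => /vlineP[a ->]; rewrite jK; exact: prol_incl_subproof.
rewrite adjoin_rcons => /Fadjoin_polyP[p /polyOverP pP ->].
rewrite horner_coef rmorph_sum; apply: rpred_sum => i _.
rewrite rmorphM rmorphXn; apply: rpredM.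
  by apply: IH (pP i) => z zrs; apply: rsP; rewrite mem_rcons inE zrs orbT.
by apply: rpredX; apply: rsP; rewrite mem_rcons mem_head.
Qed.

(** A finite part of the pro-l closure lies in K(z) for some z in the closure. The
    automorphism t sends z to a root of its minimal polynomial over K, and so does
    some automorphism of a normal extension of K containing z. *)
Lemma finite_lift (t : GKl) (M : seq P) :
  exists s : GK, forall m, m \in M -> s (val m) = val (t m).
Proof.
have [L [j [jK ML]]] := splitting_field_in_algC iota (map val M).
have /all_sig[g gE] (x : algC) : {y : L | x \in map val M -> j y = x}.
  by apply: cid; case: (boolP (x \in map val M)) => [/ML[y <-]|_]; [exists y|exists 0].
pose rs := map g (map val M).
have /and3P[_ sepL nL] := galois_full L.
have DF := eq_adjoin_separable_generator (separableSr (subvf <<1 & rs>>) sepL)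
  (subv_adjoin_seq _ _).
set z := separable_generator _ _ in DF.
have zP : prol_pred l iota (j z).
  apply: (prol_adjoin_seq (rs := rs)) => //.
    by move=> _ /mapP[x Mx ->]; rewrite gE //; case/mapP: Mx => m _ ->; exact: valP.
  by rewrite DF memv_adjoin.
pose zp : P := Prol zP.
have /polyOver1P[q Dq] := minPolyOver 1 z.
have [r _ Dr] := normalFieldP nL z (memvf _).
have iotaE (p : {poly K}) : map_poly val (map_poly (@prol_incl l K iota) p) = map_poly iota p.
  by rewrite -map_poly_comp.
have jE (p : {poly K}) : map_poly j (map_poly (in_alg L) p) = map_poly iota p.
  by rewrite -map_poly_comp; apply: eq_map_poly => a /=; rewrite jK.
have tE (p : {poly K}) :
    map_poly t (map_poly (@prol_incl l K iota) p) = map_poly (@prol_incl l K iota) p.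
  by rewrite -map_poly_comp; apply: eq_map_poly => a /=; rewrite gal_fix.
have : root (map_poly j (minPoly 1 z)) (val (t zp)).
  rewrite Dq jE -iotaE fmorph_root -tE fmorph_root -(fmorph_root val) iotaE /=.
  by rewrite -jE -Dq fmorph_root root_minPoly.
rewrite Dr rmorph_prod (eq_bigr (fun b => 'X - (j b)%:P)) /=; last first.
  by move=> b _; rewrite map_polyXsubC.
rewrite -(big_map j xpredT (fun b => 'X - b%:P)) root_prod_XsubC.
case/mapP => b br Db.
have [|h _ hz] := normalField_root_minPoly (sub1v {:L}%AS) nL (memvf z) (b := b).
  by rewrite Dr root_prod_XsubC.
have [s sh] := gal_lift jK h; exists s => m Mm.
have : g (val m) \in <<1; z>>%VS.
  by rewrite -DF seqv_sub_adjoin // !map_f.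
case/Fadjoin_polyP=> p /polyOver1P[p' ->] Eg.
have Dm : m = (map_poly (@prol_incl l K iota) p').[zp].
  apply: val_inj; rewrite -(gE (val m)) ?map_f // Eg.
  by rewrite -!horner_map /= iotaE jE.
have -> : val (t m) = (map_poly iota p').[j b].
  rewrite [in LHS]Dm -horner_map tE -(horner_map val) iotaE.
  by congr _.[_].
have -> : val m = j (g (val m)) by rewrite gE ?map_f.
have sE : map_poly s (map_poly iota p') = map_poly iota p'.
  by rewrite -map_poly_comp; apply: eq_map_poly => a /=; rewrite gal_fix.
by rewrite Eg -!horner_map /= jE sE sh hz.
Qed.

Lemma ultra_finite_value (T : Type) (U : set_system T) (A : eqType)
    (f : T -> A) (rs : seq A) :
  UltraFilter U -> U [set M | f M \in rs] -> exists y, U [set M | f M = y].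
Proof.
move=> UU; elim: rs => [|y rs IH] Urs.
  have [M //] := @filter_ex _ _ _ _ Urs.
have [?|Uy] := in_ultra_setVsetC [set M | f M = y] UU; first by exists y.
apply: IH; apply: filterS (filterI Urs Uy) => M [/=].
by rewrite inE => /orP[/eqP|//].
Qed.

(** The profinite nature of G_K: orbits on the algebraic numbers are finite. *)
Lemma gal_conjugates (x : algC) : exists rs : seq algC, forall s : GK, s x \in rs.
Proof.
have [rs Drs] := closed_field_poly_normal (minCpoly x).
exists rs => s; rewrite -root_prod_XsubC.
have := Drs; rewrite (monicP (minCpoly_monic x)) scale1r => <-.
have [p [Dp _] _] := minCpolyP x.
have <- : map_poly s (minCpoly x) = minCpoly x.
  by rewrite Dp -map_poly_comp; apply: eq_map_poly => a /=; rewrite fmorph_rat.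
by rewrite fmorph_root root_minCpoly.
Qed.

(** Compactness of G_K. For every finite set M of elements of the pro-l closure take
    an automorphism that agrees with t on M. Since each algebraic number takes
    finitely many values under these automorphisms, they converge pointwise along
    an ultrafilter containing all the sets of M that are large enough. *)
Lemma res_surj (t : GKl) : exists s : GK, res l s = t.
Proof.
have /all_sig[S SP] (M : seq P) : {s : GK | forall m, m \in M -> s (val m) = val (t m)}.
  exact: cid (finite_lift t M).
(* The filter of the sets of finite subsets M that contain all the M
   larger than some given one. *)
pose F : set_system (seq P) :=
  [set A : set (seq P) | exists M : seq P, forall M' : seq P, {subset M <= M'} -> A M'].
have FF : ProperFilter F.
  apply: Build_ProperFilter_ex; first by move=> A [M MA]; exists M; apply: MA.
  split; first by exists [::].
    move=> A B [M MA] [N NB]; exists (M ++ N) => M' sM; split.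
      by apply: MA => m Mm; apply: sM; rewrite mem_cat Mm.
    by apply: NB => m Mm; apply: sM; rewrite mem_cat Mm orbT.
  by move=> A B sAB [M MA]; exists M => M' /MA /sAB.
have [U [UU FU]] := ultraFilterLemma FF.
have lim (f : seq P -> GK) x : {y | U [set M | f M x = y]}.
  apply: cid; have [rs rsP] := gal_conjugates x.
  by apply: (@ultra_finite_value _ U _ (fun M => f M x) rs) => //; apply: filterS filterT => M _ /=.
pose s x := sval (lim S x).
have sP x : U [set M | S M x = s x] by exact: svalP (lim S x).
have sB : zmod_morphism s.
  move=> x y; have [M [<- [<- <-]]] := @filter_ex _ _ _ _ (filterI (sP (x - y)) (filterI (sP x) (sP y))).
  by rewrite rmorphB.
have sM : monoid_morphism s.
  split=> [|x y]; first by have [M <-] := @filter_ex _ _ _ _ (sP 1); rewrite rmorph1.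
  have [M [<- [<- <-]]] := @filter_ex _ _ _ _ (filterI (sP (x * y)) (filterI (sP x) (sP y))).
  by rewrite rmorphM.
pose s' y := sval (lim (fun M => (S M)^-1%g) y).
have s'P y : U [set M | (S M)^-1%g y = s' y] by exact: svalP (lim (fun M => (S M)^-1%g) y).
have s_bij : bijective s.
  exists s' => x.
    have [M [/= <- <-]] := @filter_ex _ _ _ _ (filterI (s'P (s x)) (sP x)).
    exact: (congr1 (fun u : GK => u x) (mulVg (S M))).
  have [M [/= <- <-]] := @filter_ex _ _ _ _ (filterI (sP (s' x)) (s'P x)).
  exact: (congr1 (fun u : GK => u x) (mulgV (S M))).
have s_fix a : s (iota a) = iota a.
  by have [M <-] := @filter_ex _ _ _ _ (sP (iota a)); rewrite gal_fix.
exists (Defs.Gal sB sM s_bij s_fix); apply: gal_ext => x; apply: val_inj => /=.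
have Ux : U [set M : seq P | x \in M].
  by apply: FU; exists [:: x] => M sM' /=; apply: sM'; rewrite mem_head.
have [M [/= xM <-]] := @filter_ex _ _ _ _ (filterI Ux (sP (val x))).
exact: SP.
Qed.

End ResSurjective.

(** * Krull topology and descent to the pro-l quotient *)

Section GalTopology.
Variables (E L : fieldType) (i : E -> L).
Local Notation G := (Defs.gal i).

Lemma galV_app (s t : G) x : s x = t x -> (s^-1 * t)%g x = x.
Proof.
by move=> /= <-; exact: (congr1 (fun u : G => u x) (mulVg s)).
Qed.

Lemma continuous_at1 (T : Type) (f : G -> T) : gal_continuous f ->
  exists xs : seq L, forall s : G, {in xs, forall x, s x = x} -> f s = f 1%g.
Proof. by move=> /(_ 1%g)[xs xsP]; exists xs => s /xsP. Qed.

Lemma continuous_comp2 (T U V : Type) (h : T -> U -> V) (f : G -> T) (g : G -> U) :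
  gal_continuous f -> gal_continuous g -> gal_continuous (fun s => h (f s) (g s)).
Proof.
move=> cf cg s; have [xs xsP] := cf s; have [ys ysP] := cg s.
exists (xs ++ ys) => t st; rewrite xsP ?ysP // => x xs_x; apply: st.
  by rewrite mem_cat xs_x orbT.
by rewrite mem_cat xs_x.
Qed.

Lemma continuous_comp (T U : Type) (h : T -> U) (f : G -> T) :
  gal_continuous f -> gal_continuous (h \o f).
Proof. by move=> cf s; have [xs xsP] := cf s; exists xs => t /xsP /= ->. Qed.

Lemma continuous_cst (T : Type) (c : T) : gal_continuous (fun _ : G => c).
Proof. by move=> s; exists [::]. Qed.

Lemma top_generated_sub (A : set G) : A `<=` top_generated A.
Proof. by move=> s As xs; exists s; split=> [x //|H _]; apply. Qed.

(** The kernel of a continuous character is a closed subgroup. *)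
Lemma top_generated_min (A : set G) l (f : G -> 'F_l) :
    H1 f -> (forall s, A s -> f s = 0) ->
  forall s, top_generated A s -> f s = 0.
Proof.
move=> [fc fM] fA s gs; have [xs xsP] := fc s.
have [t [st gt]] := gs xs; rewrite -(xsP t st); apply: (gt [set s | f s = 0]) => //.
have f1 : f 1%g = 0 by apply: (addrI (f 1%g)); rewrite -fM mulg1 addr0.
split=> //= [u v fu fv|u fu]; first by rewrite fM fu fv addr0.
by apply: (addrI (f u)); rewrite -fM mulgV f1 fu addr0.
Qed.

Section CharacterGroup.
Variable l : nat.

Lemma H1_0 : H1 (0 : G -> 'F_l).
Proof. by split=> [|s t]; [exact: continuous_cst|rewrite addr0]. Qed.

Lemma H1_D (f g : G -> 'F_l) : H1 f -> H1 g -> H1 (f + g).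
Proof.
move=> [cf fM] [cg gM]; split; first exact: (continuous_comp2 +%R cf cg).
by move=> s t; rewrite !fctE fM gM addrACA.
Qed.

Lemma H1_Z (a : 'F_l) (f : G -> 'F_l) : H1 f -> H1 (a \*o f).
Proof.
move=> [cf fM]; split; first exact: (continuous_comp ( *%R a) cf).
by move=> s t /=; rewrite fM mulrDr.
Qed.

Lemma H1_N (f : G -> 'F_l) : H1 f -> H1 (- f).
Proof.
move=> [cf fM]; split; first exact: (continuous_comp -%R cf).
by move=> s t; rewrite !fctE fM opprD.
Qed.

Lemma H1_B (f g : G -> 'F_l) : H1 f -> H1 g -> H1 (f - g).
Proof. by move=> Hf Hg; apply/H1_D/H1_N. Qed.

Lemma H1_sum (I : Type) (r : seq I) (P : pred I) (f : I -> G -> 'F_l) :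
  (forall i, P i -> H1 (f i)) -> H1 (\sum_(i <- r | P i) f i).
Proof. move=> fH; elim/big_rec: _ => [|j x Pj Hx]; [exact: H1_0|exact: H1_D (fH _ Pj) Hx]. Qed.

Lemma H1_1 (f : G -> 'F_l) : H1 f -> f 1%g = 0.
Proof. by move=> [_ fM]; apply: (addrI (f 1%g)); rewrite -fM mulg1 addr0. Qed.

End CharacterGroup.
End GalTopology.

Section Descend.
Variables (l : nat) (K : fieldExtType rat) (iota : {rmorphism K -> algC}).
Hypothesis l_pr : prime l.
Local Notation GK := (Defs.gal iota).
Local Notation P := (prol l iota).
Local Notation GKl := (Defs.gal (prol_incl l iota)).

Lemma res_liftK (t : GKl) : res l (Defs.lift t) = t.
Proof. exact: (xgetPex 1%g (res_surj t)). Qed.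

Lemma resM (s t : GK) : res l (s * t)%g = (res l s * res l t)%g.
Proof. by apply: gal_ext => x; apply: val_inj. Qed.

Lemma res1 : res l (1%g : GK) = 1%g.
Proof. by apply: gal_ext => x; apply: val_inj. Qed.

Lemma res_continuous (T : Type) (f : GKl -> T) :
  gal_continuous f -> gal_continuous (f \o @res l K iota).
Proof.
move=> cf s; have [xs xsP] := cf (res l s); exists (map val xs) => t st /=.
by apply: xsP => x xs_x; apply: val_inj; apply: st; rewrite map_f.
Qed.

Definition factors_prol (T : Type) (f : GK -> T) :=
  (forall s t : GK, res l s = res l t -> f s = f t) /\
  gal_continuous (descend (l := l) f).

Lemma descendE (T : Type) (f : GK -> T) s : factors_prol f ->
  descend (l := l) f (res l s) = f s.
Proof. by case=> fP _; apply: fP; rewrite res_liftK. Qed.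

Lemma normal_factors_prol (T : Type) (f : GK -> T) (N : set GK) (xs : seq algC) k :
    gal_subgroup N -> (forall s t, N s -> N (t * s * t^-1)%g) ->
    (forall s : GK, {in xs, forall x, s x = x} -> N s) ->
    (forall s, N (s ^+ (l ^ k))%g) ->
    (forall s t, N s -> f (t * s)%g = f t) ->
  factors_prol f.
Proof.
move=> N1 N2 N3 N4 fN; have [ys ysP] := open_normal_prol l_pr N1 N2 N3 N4.
have fP (s t : GK) : {in ys, forall y : P, s (val y) = t (val y)} -> f t = f s.
  move=> st; rewrite -[t](mulKVg s); apply/fN/ysP => y /st.
  exact: galV_app.
split=> [s t st|t].
  apply/esym/fP=> y _; exact: (congr1 (fun u : GKl => val (u y)) st).
exists ys => u ut; apply: fP => y /ut; rewrite -{1}(res_liftK u) -{1}(res_liftK t).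
by move/(congr1 val) => /= ->.
Qed.

(** Meant for N the kernel of a homomorphism to G_i, and phi a cochain whose
    coboundary is the pullback of a cocycle on G_i. Then phi is additive along N,
    and the zeros of phi in N form an open normal subgroup whose quotient has
    exponent dividing l^(k+1). *)
Lemma cochain_factors_prol (phi : GK -> 'F_l) (N : set GK) (xs : seq algC) k :
    gal_subgroup N -> (forall s t, N s -> N (t * s * t^-1)%g) ->
    (forall s : GK, {in xs, forall x, s x = x} -> N s) ->
    (forall s, N (s ^+ (l ^ k))%g) ->
    gal_continuous phi ->
    (forall s t, N s -> phi (t * s)%g = phi t + phi s) ->
    (forall s t, N s -> phi (s * t)%g = phi s + phi t) ->
  factors_prol phi.
Proof.
move=> [N1 NM NV] NJ Nxs NX cphi phiR phiL.
have phi1 : phi 1%g = 0 by apply: (addrI (phi 1%g)); rewrite -phiR // mulg1 addr0.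
have [zs zsP] := continuous_at1 cphi.
pose N' := [set s | N s /\ phi s = 0].
apply: (@normal_factors_prol _ phi N' (xs ++ zs) k.+1).
- split=> //= [s t [Ns s0] [Nt t0]|s [Ns s0]]; split;
    rewrite ?phiR ?s0 ?t0 ?addr0 //; [exact: NM|exact: NV|].
  by apply: (addrI (phi s)); rewrite -phiR ?mulgV ?s0 ?phi1 ?addr0 //; exact: NV.
- move=> s t [Ns s0]; have NJs := NJ s t Ns; split=> //.
  by apply: (addIr (phi t)); rewrite -phiL // mulgKV phiR // s0 addrC.
- move=> s sx; split; first by apply: Nxs => x xs_x; apply: sx; rewrite mem_cat xs_x.
  by rewrite zsP // => x zs_x; apply: sx; rewrite mem_cat zs_x orbT.
- move=> s; rewrite expnSr expgM; set t := (s ^+ _)%g; have Nt : N t by exact: NX.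
  have H n : N (t ^+ n)%g /\ phi (t ^+ n)%g = phi t *+ n.
    elim: n => [|n [Nn IH]]; first by rewrite expg0 mulr0n.
    by rewrite expgS phiR // IH mulrS; split=> //; apply: NM.
  have [Nl e] := H l; split=> //; rewrite e; exact: mulrn_pchar (pchar_Fp l_pr) _.
- by move=> s t [Ns s0]; rewrite phiR // s0 addr0.
Qed.

Lemma H1_factors_prol (chi : GK -> 'F_l) : H1 chi -> factors_prol chi.
Proof. 
move=> [cc cM]; apply: (@cochain_factors_prol chi setT [::] 0) => //.
Qed.

Lemma descend_H1 (chi : GK -> 'F_l) : H1 chi -> H1 (descend (l := l) chi).
Proof.
move=> Hc; have fc := H1_factors_prol Hc; split; first by have [] := fc.
by move=> s t; rewrite -{1}(res_liftK s) -{1}(res_liftK t) -resM descendE //; case: Hc.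
Qed.

End Descend.

(** * Rings of integers: residues, primes and products of primes *)

Section Integers.
Variable K : fieldExtType rat.
Local Notation O := (@ring_of_integers K).

Lemma roi_int (n : int) : O n%:~R. Proof. exact: (integral_id intr n). Qed.
Lemma roi_nat (n : nat) : O n%:R. Proof. exact: (roi_int n). Qed.
Lemma roi0 : O 0. Proof. exact: (roi_nat 0). Qed.
Lemma roi1 : O 1. Proof. exact: (roi_nat 1). Qed.
Lemma roiD x y : O x -> O y -> O (x + y). Proof. exact: integral_add. Qed.
Lemma roiN x : O x -> O (- x). Proof. exact: integral_opp. Qed.
Lemma roiB x y : O x -> O y -> O (x - y). Proof. exact: integral_sub. Qed.
Lemma roiM x y : O x -> O y -> O (x * y). Proof. exact: integral_mul. Qed.
Lemma roiX x n : O x -> O (x ^+ n).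
Proof. by move=> Ox; elim: n => [|n IH]; [exact: roi1|rewrite exprS; exact: roiM]. Qed.
Lemma roi_sum (I : Type) (r : seq I) (P : pred I) (f : I -> K) :
  (forall i, P i -> O (f i)) -> O (\sum_(i <- r | P i) f i).
Proof. by move=> fO; elim/big_rec: _ => [|i x Pi Ox]; [exact: roi0|exact: roiD (fO _ Pi) Ox]. Qed.
Lemma roi_horner (p : {poly int}) x : O x -> O (map_poly intr p).[x].
Proof.
move=> Ox; rewrite horner_coef; apply: roi_sum => i _; rewrite coef_map /=.
by apply: roiM; [exact: roi_int|exact: roiX].
Qed.

Lemma natK_eq0 n : (n%:R == 0 :> K) = (n == 0)%N.
Proof. by rewrite -(rmorph_nat (in_alg K)) fmorph_eq0 pnatr_eq0. Qed.
(** Linear independence over F_p of the classes of the entries of x in the quotient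
    of the ring of integers by p. *)
Definition indep_mod (p n : nat) (x : n.-tuple K) :=
  (forall i, O (tnth x i)) /\
  forall a : 'I_n -> int, (exists2 z, O z & \sum_i (a i)%:~R * tnth x i = p%:R * z) ->
    forall i, (p %| a i)%Z.

(** The integral coefficients of a linear relation would be divisible by every power
    of p: dividing all of them by p gives another relation. *)
Lemma indep_mod_free p n (x : n.-tuple K) : prime p -> indep_mod p x ->
  (n <= \dim {:K})%N.
Proof.
move=> p_pr [xO x_ind].
have p0 : p%:R != 0 :> K by rewrite natK_eq0 -lt0n prime_gt0.
have step m (a : 'I_n -> int) : \sum_i (a i)%:~R * tnth x i = 0 :> K ->
    forall i, ((p ^ m)%N %| a i)%Z.
  elim: m a => [|m IH] a ax i; first by rewrite expn0 dvd1z.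
  have pa : forall i, (p %| a i)%Z.
    by apply: x_ind; exists 0; [exact: roi0|rewrite mulr0].
  pose b i := (a i %/ p)%Z; have ab k : a k = b k * p%:Z by rewrite divzK.
  have /(IH b)/(_ i) : \sum_i (b i)%:~R * tnth x i = 0 :> K.
    apply: (mulfI p0); rewrite mulr0 -[RHS]ax mulr_sumr; apply: eq_bigr => k _.
    by rewrite ab rmorphM /= mulrA [_%:~R * _]mulrC.
  by rewrite ab expnSr PoszM dvdz_mul2r // -?lt0n ?prime_gt0.
suff /freeP fx : free x.
  have : free x by apply/freeP.
  by rewrite /free size_tuple => /eqP <-; rewrite dimvS // subvf.
apply/freeP => k kx i.
pose d := \prod_i denq (k i).
have d0 : d != 0 by apply/prodf_neq0 => j _; exact: denq_neq0.
(* The a i are the numerators of the k i over the common denominator d. *)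
pose a i := numq (k i) * \prod_(j | j != i) denq (k j).
have aE j : (a j)%:~R = d%:~R * k j :> rat.
  rewrite /a /d [in RHS](bigD1 j) //= !rmorphM /= -[X in _ = _ * X]divq_num_den.
  rewrite mulrC [X in _ = X * _]mulrC -!mulrA; congr (_ * _).
  by rewrite mulrCA mulfV ?mulr1 // intr_eq0 denq_neq0.
have ax : \sum_j (a j)%:~R * tnth x j = 0 :> K.
  rewrite -[RHS](scaler0 _ (d%:~R : rat)) -[in RHS]kx scaler_sumr.
  apply: eq_bigr => j _; rewrite scalerA -aE (tnth_nth 0) -mulr_algl.
  by rewrite -in_algE rmorph_int.
have ai0 : a i = 0.
  apply/eqP/negPn/negP => ai0; have := step `|a i|%N a ax i.
  rewrite dvdzE /= => /dvdn_leq; rewrite absz_gt0 => /(_ ai0).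
  by rewrite leqNgt ltn_expl // prime_gt1.
have := aE i; rewrite ai0 => /esym/eqP; rewrite mulf_eq0 intr_eq0 (negPf d0) /=.
by move/eqP.
Qed.

(** By [indep_mod_free] there is a maximal independent family modulo p. Every
    integral element is congruent to a combination of it, with coefficients that
    can be reduced to [0, p). *)
Lemma residues_finite p : prime p -> exists R : seq K,
  (forall y, y \in R -> O y) /\
  forall x, O x -> exists2 y, y \in R & exists2 z, O z & x = y + p%:R * z.
Proof.
move=> p_pr.
pose Q n := `[< exists x : n.-tuple K, indep_mod p x >].
have Qbd n : Q n -> (n <= \dim {:K})%N by move=> /asboolP[x]; apply: indep_mod_free.
have Qex : exists n, Q n.
  by exists 0%N; apply/asboolP; exists [tuple]; split=> [[]|a _ []].
have [n /asboolP[x [xO x_ind]] n_max] := ex_maxnP Qex Qbd.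
pose R := [seq \sum_i (c i)%:R * tnth x i | c : {ffun 'I_n -> 'I_p}].
exists R; split=> [_ /mapP[c _ ->]|y Oy].
  by apply: roi_sum => i _; apply: roiM => //; exact: roi_nat.
have : ~ indep_mod p [tuple of y :: x].
  move=> H; have /n_max : Q n.+1 by apply/asboolP; exists [tuple of y :: x].
  by rewrite ltnn.
move=> /not_andP[]; first by case=> i; case: (unliftP ord0 i) => [j|] ->; rewrite ?tnthS // tnth0.
move/existsNP => [a /not_implyP[[z Oz]]].
rewrite big_ord_recl tnth0 (eq_bigr (fun i => (a (lift ord0 i))%:~R * tnth x i)); last first.
  by move=> i _; rewrite tnthS.
move=> Eaz /existsNP[i0 pai0].
have pa0 : ~~ (p %| a ord0)%Z.
  apply/negP => /dvdzP[b Eb]; apply: pai0.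
  have pax : forall i, (p %| a (lift ord0 i))%Z.
    apply: (x_ind (fun i => a (lift ord0 i))); exists (z - b%:~R * y).
      by apply: roiB => //; apply: roiM => //; exact: roi_int.
    have -> : p%:R = (p : int)%:~R :> K by [].
    by rewrite mulrBr -Eaz Eb rmorphM /= mulrA [_ * b%:~R]mulrC addrAC subrr add0r.
  by case: (unliftP ord0 i0) => [j|] ->; [exact: pax|rewrite Eb dvdz_mull].
have : coprimez (a ord0) p.
  by rewrite coprimezE coprime_sym prime_coprime // -dvdzE.
case/coprimezP=> [[u v] /= uv].
have p_gt0 := prime_gt0 p_pr.
pose e i := - (u * a (lift ord0 i)).
have cP i : (`|(e i %% p)%Z| < p)%N.
  have := ltz_pmod (e i) (d := p%:Z) p_gt0.
  by rewrite -{1}[(_ %% _)%Z]gez0_abs // modz_ge0 // -lt0n.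
pose c := [ffun i => Ordinal (cP i)].
exists (\sum_i (c i)%:R * tnth x i); first by apply: map_f; rewrite mem_enum.
exists (u%:~R * z + v%:~R * y + \sum_i (e i %/ p)%Z%:~R * tnth x i).
  apply: roiD; first by apply: roiD; apply: roiM => //; exact: roi_int.
  by apply: roi_sum => i _; apply: roiM => //; exact: roi_int.
have eE i : (e i)%:~R = (c i)%:R + p%:R * (e i %/ p)%Z%:~R :> K.
  rewrite ffunE /= {1}(divz_eq (e i) p) rmorphD rmorphM /= addrC mulrC.
  congr (_ + _); rewrite -{1}[(_ %% _)%Z]gez0_abs // modz_ge0 // -lt0n //.
set A := \sum_i _ in Eaz; set S := \sum_i _; set T := \sum_i _.
have ST : S + p%:R * T = - (u%:~R * A).
  rewrite /S /T /A !mulr_sumr -sumrN -big_split; apply: eq_bigr => i _ /=.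
  by rewrite mulrA -mulrDl -eE rmorphN rmorphM /= mulNr mulrA.
have -> : S + p%:R * (u%:~R * z + v%:~R * y + T) =
  (S + p%:R * T) + u%:~R * (p%:R * z) + v%:~R * p%:R * y by ring.
rewrite ST -Eaz.
have e1 : u%:~R * (a ord0)%:~R + v%:~R * p%:R = 1 :> K.
  by have := congr1 (fun n : int => n%:~R : K) uv; rewrite rmorphD !rmorphM.
by rewrite -[LHS]mul1r -[in LHS]e1; ring.
Qed.

Section Place.
Variable q : finite_place K.

Lemma placeO x : place_ideal q x -> O x. Proof. by case: (place_integral q) => + _ _ _; apply. Qed.
Lemma place0 : place_ideal q 0. Proof. by case: (place_integral q). Qed.
Lemma placeD x y : place_ideal q x -> place_ideal q y -> place_ideal q (x + y).
Proof. by case: (place_integral q) => _ _ + _; apply. Qed.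
Lemma placeMl a x : O a -> place_ideal q x -> place_ideal q (a * x).
Proof. by case: (place_integral q) => _ _ _; apply. Qed.
Lemma placeMr a x : O a -> place_ideal q x -> place_ideal q (x * a).
Proof. by rewrite mulrC; apply: placeMl. Qed.
Lemma placeN x : place_ideal q x -> place_ideal q (- x).
Proof. by move=> qx; rewrite -mulN1r; apply: placeMl => //; apply: roiN; exact: roi1. Qed.
Lemma placeB x y : place_ideal q x -> place_ideal q y -> place_ideal q (x - y).
Proof. by move=> qx qy; apply/placeD/placeN. Qed.
Lemma placeX x n : O x -> place_ideal q (x ^+ n) -> place_ideal q x.
Proof.
move=> Ox; elim: n => [/place_proper //|n IH]; rewrite exprS.
by move/place_prime => []//; exact: roiX.
Qed.

(** The constant term of an equation satisfied by x is a multiple of x; a vanishing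
    constant term can be removed by dividing the equation by the variable. *)
Lemma place_int_poly (p : {poly int}) x : place_ideal q x -> x != 0 -> p != 0 ->
  root (map_poly intr p) x -> exists2 n : int, n != 0 & place_ideal q n%:~R.
Proof.
move=> qx x0; elim/poly_ind: p => [|p c IH]; first by rewrite eqxx.
have Ox := placeO qx.
rewrite rmorphD rmorphM /= map_polyX map_polyC /= rootE !hornerE => p0.
have [c0|c0 /eqP E] := eqVneq c 0.
  rewrite c0 addr0 mulf_eq0 (negPf x0) orbF => px; apply: IH => //.
  by apply: contra_neq p0 => ->; rewrite mul0r add0r c0 polyC0.
exists c => //.
have -> : c%:~R = - ((map_poly intr p).[x] * x).
  by apply/eqP; rewrite -addr_eq0 addrC E.
by apply/placeN/placeMl => //; exact: roi_horner.
Qed.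

Lemma place_int : exists2 n : int, n != 0 & place_ideal q n%:~R.
Proof.
have [x qx x0] := place_neq0 q; have [p mp px] := placeO qx.
exact: (place_int_poly qx x0 (monic_neq0 mp) px).
Qed.

Lemma place_prime_nat n : (0 < n)%N -> place_ideal q n%:R ->
  exists p, [/\ prime p, (p %| n)%N & place_ideal q p%:R].
Proof.
elim/ltn_ind: n => n IH n0 qn.
have n1 : (1 < n)%N.
  by rewrite ltn_neqAle n0 andbT; apply/eqP => n1; move: qn; rewrite -n1; exact: place_proper.
have pn := pdiv_dvd n; have p_pr := pdiv_prime n1.
move: qn; rewrite -{1}(divnK pn) natrM => /place_prime [||qm|qp]; [exact: roi_nat|exact: roi_nat| |].
  have [||p [? pm ?]] := IH _ _ _ qm.
  - by rewrite ltn_Pdiv // prime_gt1.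
  - by rewrite divn_gt0 ?pdiv_gt0 // dvdn_leq.
  by exists p; split=> //; apply: dvdn_trans pm (dvdn_div pn).
by exists (pdiv n).
Qed.

Lemma place_above : exists2 p, prime p & place_ideal q p%:R.
Proof.
have [n n0 qn] := place_int.
have qn' : place_ideal q (`|n|%N)%:R.
  by case: (intP n) n0 qn => // m _; rewrite ?rmorphN ?abszN //= => /placeN; rewrite ?opprK.
have [|p [p_pr _ qp]] := place_prime_nat _ qn'; first by rewrite absz_gt0.
by exists p.
Qed.

(** The residue ring at q is finite, so two powers of x are congruent modulo q. *)
Lemma place_unit_order x : O x -> ~ place_ideal q x ->
  exists m, place_ideal q (x ^+ m.+1 - 1).
Proof.
move=> Ox nqx; have [p p_pr qp] := place_above.
have [R [RO Rrep]] := residues_finite p_pr.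
have /all_sig[i iP] (n : nat) : {i : 'I_(size R) | place_ideal q (x ^+ n - R`_i)}.
  apply: cid; have [y yR [z Oz E]] := Rrep _ (roiX n Ox).
  have lt : (index y R < size R)%N by rewrite index_mem.
  exists (Ordinal lt) => /=; rewrite nth_index // E addrC addKr mulrC.
  exact: placeMl.
(* Pigeonhole: one more power of x than there are classes. *)
pose f (n : 'I_(size R).+1) := i n.
have : ~ injective f.
  by move=> /leq_card; rewrite !card_ord ltnn.
move/existsNP => [a /existsNP[b /not_implyP[fab ab]]].
wlog lt_ab : a b fab ab / (a < b)%N.
  move=> H; have [ltab|ltba|/val_inj E] := ltngtP a b; last by case: ab.
    exact: (H a b).
  by apply: (H b a) => // ba; apply: ab.
exists (b - a).-1; rewrite prednK ?subn_gt0 //.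
have : place_ideal q (x ^+ a * (x ^+ (b - a) - 1)).
  rewrite mulrBr mulr1 -exprD subnKC 1?ltnW //.
  have -> : x ^+ b - x ^+ a = (x ^+ b - R`_(f a)) - (x ^+ a - R`_(f a)) by ring.
  by apply: placeB; [rewrite fab|]; exact: iP.
case/place_prime => //; [exact: roiX|by apply: roiB roi1; exact: roiX|].
by move/(placeX Ox).
Qed.

End Place.

Lemma place_ext (q q' : finite_place K) :
  (forall x, place_ideal q x <-> place_ideal q' x) -> q = q'.
Proof.
case: q q' => I i1 i2 i3 i4 [J j1 j2 j3 j4] /= IJ.
have E : I = J by apply/seteqP; split=> x /IJ.
case: _ / E in j1 j2 j3 j4 {IJ} *.
congr FinitePlace; exact: Prop_irrelevance.
Qed.

(** Nonzero primes are maximal: for x in q' outside q, some power of x with positive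
    exponent is 1 modulo q, hence modulo q', which contains x. *)
Lemma place_maximal (q q' : finite_place K) :
  (forall x, place_ideal q x -> place_ideal q' x) -> q = q'.
Proof.
move=> qq'; apply: place_ext => x; split=> [/qq'//|q'x].
have Ox := placeO q'x; have [//|nqx] := pselect (place_ideal q x).
have [m /qq' qm] := place_unit_order Ox nqx; exfalso.
apply: (@place_proper _ q').
have -> : 1 = x ^+ m.+1 - (x ^+ m.+1 - 1) by ring.
apply: placeB => //; rewrite exprS; apply: placeMr => //; exact: roiX.
Qed.

(** A prime ideal containing the rational prime p is determined by the classes modulo
    p that it contains, and there are finitely many classes. *)
Lemma finite_places_above (n : nat) : (0 < n)%N ->
  finite_set [set q : finite_place K | place_ideal q n%:R].
Proof.
elim/ltn_ind: n => n IH n0.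
have [n1|n1] := leqP n 1.
  apply: (sub_finite_set _ (finite_set0 _)) => q /=.
  have -> : n = 1%N by apply/eqP; rewrite eqn_leq n1.
  exact: place_proper.
have pn := pdiv_dvd n; have p_pr := pdiv_prime n1.
have [R [RO Rrep]] := residues_finite p_pr.
apply: (@sub_finite_set _ _ ([set q : finite_place K | place_ideal q (n %/ pdiv n)%:R] `|`
                             [set q : finite_place K | place_ideal q (pdiv n)%:R])).
  move=> q /=; rewrite -{1}(divnK pn) natrM => /place_prime []; try exact: roi_nat; by [left|right].
rewrite finite_setU; split.
  apply: IH; first by rewrite ltn_Pdiv // prime_gt1.
  by rewrite divn_gt0 ?pdiv_gt0 // dvdn_leq.
pose F (q : finite_place K) :=
  (`[< place_ideal q (pdiv n)%:R >],
   [ffun i : 'I_(size R) => `[< place_ideal q R`_i >]]).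
have -> : [set q : finite_place K | place_ideal q (pdiv n)%:R] =
    F @^-1` [set b : bool * {ffun 'I_(size R) -> bool} | is_true b.1].
  by apply/seteqP; split=> q /= /asboolP.
apply: finite_preimage; last exact: finite_finset.
move=> q q'; rewrite !inE /= => /asboolP qp /asboolP q'p [_ /ffunP eF].
apply: place_maximal => x qx; have [y yR [z Oz E]] := Rrep _ (placeO qx).
have lt : (index y R < size R)%N by rewrite index_mem.
have qy : place_ideal q y.
  have -> : y = x - z * (pdiv n)%:R by rewrite E; ring.
  by apply/placeB/placeMl.
have /asboolP : `[< place_ideal q' R`_(index y R) >].
  by have := eF (Ordinal lt); rewrite !ffunE /= => <-; apply/asboolP; rewrite nth_index.
rewrite nth_index // E => q'y; apply: placeD => //; exact: placeMr.
Qed.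

Local Notation ideal := (@integral_ideal K).

Lemma ideal_sub_roi (I : set K) : ideal I -> I `<=` O. Proof. by case. Qed.

Lemma ideal_sum (I : set K) (T : eqType) (r : seq T) (f : T -> K) :
  ideal I -> (forall i, i \in r -> I (f i)) -> I (\sum_(i <- r) f i).
Proof.
move=> [_ I0 ID _]; elim: r => [|i r IH] fI; first by rewrite big_nil.
rewrite big_cons; apply: ID; first by apply: fI; rewrite mem_head.
by apply: IH => k kr; apply: fI; rewrite inE kr orbT.
Qed.

Lemma ideal_roi : ideal O.
Proof. by split=> //; [exact: roi0|exact: roiD|exact: roiM]. Qed.

Lemma ideal_mulP (I J : set K) x y : I x -> J y -> ideal_mul I J (x * y).
Proof. by move=> Ix Jy; exists [:: (x, y)]; [move=> p /[!inE]/eqP->|rewrite big_seq1]. Qed.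

Lemma ideal_mul_min (I J L : set K) : ideal L ->
  (forall x y, I x -> J y -> L (x * y)) -> ideal_mul I J `<=` L.
Proof.
move=> idL IJL _ [s sIJ ->]; apply: ideal_sum => // p /sIJ[].
exact: IJL.
Qed.

Lemma ideal_mul_ideal (I J : set K) : ideal I -> ideal J -> ideal (ideal_mul I J).
Proof.
move=> idI idJ; split.
- apply: ideal_mul_min; first exact: ideal_roi.
  by move=> x y /(ideal_sub_roi idI) ? /(ideal_sub_roi idJ) ?; apply: roiM.
- by exists [::] => //; rewrite big_nil.
- move=> _ _ [s sIJ ->] [t tIJ ->]; exists (s ++ t); last by rewrite big_cat.
  by move=> p; rewrite mem_cat => /orP[/sIJ|/tIJ].
- move=> a _ Oa [s sIJ ->]; exists [seq (a * p.1, p.2) | p <- s].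
    move=> _ /mapP[p /sIJ[Ip Jp] ->]; split=> //=.
    by case: idI => _ _ _; apply.
  by rewrite big_map mulr_sumr; apply: eq_bigr => p _; rewrite mulrA.
Qed.

Lemma ideal_mulC (I J : set K) : ideal_mul I J = ideal_mul J I.
Proof.
suff H (A B : set K) : ideal_mul A B `<=` ideal_mul B A by apply/seteqP; split; exact: H.
move=> _ [s sAB ->]; exists [seq (p.2, p.1) | p <- s].
  by move=> _ /mapP[p /sAB[Ip Jp] ->].
by rewrite big_map; apply: eq_bigr => p _; rewrite mulrC.
Qed.

Lemma ideal_mulA (I J L : set K) : ideal I -> ideal J -> ideal L ->
  ideal_mul I (ideal_mul J L) = ideal_mul (ideal_mul I J) L.
Proof.
move=> idI idJ idL; have idIJ := ideal_mul_ideal idI idJ.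
have idJL := ideal_mul_ideal idJ idL.
have idl := ideal_mul_ideal idI idJL; have idr := ideal_mul_ideal idIJ idL.
apply/seteqP; split; apply: ideal_mul_min => //.
  move=> x _ Ix [s sJL ->]; rewrite mulr_sumr; apply: ideal_sum => // p /sJL[Jp Lp].
  by rewrite mulrA; apply: ideal_mulP => //; apply: ideal_mulP.
move=> _ y [s sIJ ->] Ly; rewrite mulr_suml; apply: ideal_sum => // p /sIJ[Ip Jp].
by rewrite -mulrA; apply: ideal_mulP => //; apply: ideal_mulP.
Qed.

Local Notation pprod s := (ideal_prod (map (@place_ideal K) s)).

Lemma ideal_pprod (s : seq (finite_place K)) : ideal (pprod s).
Proof.
elim: s => [|q s IH] /=; first exact: ideal_roi.
by apply: ideal_mul_ideal => //; exact: place_integral.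
Qed.

Lemma ideal_prod_rem (s : seq (finite_place K)) q : q \in s ->
  pprod s = ideal_mul (place_ideal q) (pprod (rem q s)).
Proof.
elim: s => // q' s IH; rewrite inE /= eq_sym; have [->//|_] := eqVneq; rewrite /=.
move=> /IH ->; have i1 := place_integral q; have i2 := place_integral q'.
have i3 := ideal_pprod (rem q s).
by rewrite ideal_mulA // [ideal_mul (place_ideal q') _]ideal_mulC -ideal_mulA.
Qed.

Lemma ideal_prod_perm (s t : seq (finite_place K)) : perm_eq s t -> pprod s = pprod t.
Proof.
elim: s t => [|q s IH] t pst; first by move: pst; rewrite perm_sym => /perm_nilP ->.
have qt : q \in t by rewrite -(perm_mem pst) mem_head.
rewrite /= (ideal_prod_rem qt) (IH (rem q t)) // -(perm_cons q).
exact: perm_trans pst (perm_to_rem qt).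
Qed.

(** A prime ideal containing a product of ideals contains one of them, and
    inclusions between the factors are equalities by [place_maximal]. *)
Lemma pprod_sub_place (s : seq (finite_place K)) q :
  (pprod s `<=` place_ideal q) -> q \in s.
Proof.
elim: s => [|q' s IH] /= sq; first by case: (@place_proper _ q); apply: sq; exact: roi1.
rewrite inE; case: eqP => //= qq'; apply: IH => y sy.
have [//|nqy] := pselect (place_ideal q y).
case: qq'; apply/esym/place_maximal => x q'x.
have /place_prime[] //: place_ideal q (x * y) by apply: sq; apply: ideal_mulP.
  exact: placeO q'x.
exact: ideal_sub_roi (ideal_pprod s) _ sy.
Qed.

Lemma pprod_place (s : seq (finite_place K)) q : q \in s -> pprod s `<=` place_ideal q.
Proof.
move/ideal_prod_rem ->; apply: ideal_mul_min; first exact: place_integral.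
by move=> x y qx /(ideal_sub_roi (ideal_pprod _)) Oy; apply: placeMr.
Qed.

Lemma ideal_dvd_pprod (s : seq (finite_place K)) q :
  ideal_dvd (place_ideal q) (pprod s) <-> q \in s.
Proof.
split=> [[M idM EM]|/ideal_prod_rem ->]; last by exists (pprod (rem q s)) => //; exact: ideal_pprod.
apply: pprod_sub_place; rewrite EM; apply: ideal_mul_min; first exact: place_integral.
by move=> x y qx /(ideal_sub_roi idM) Oy; apply: placeMr.
Qed.

Lemma ideal_coprime_mulr (I J L : set K) : ideal I -> ideal J -> ideal L ->
  ideal_coprime I J -> ideal_coprime I L -> ideal_coprime I (ideal_mul J L).
Proof.
move=> idI idJ idL [x [y [Ix Jy xy]]] [x' [z [Ix' Lz xz]]].
have [_ _ ID IM] := idI.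
(* Expansion of (x + y) * (x' + z). *)
exists (z * x + y * x' + x * x'), (y * z); split; last 1 first.
- transitivity ((x + y) * (x' + z)); first by ring.
  by rewrite xy xz mul1r.
- by apply: (ID); [apply: (ID)|]; apply: (IM) => //;
    [exact: ideal_sub_roi Lz|exact: ideal_sub_roi Jy|exact: ideal_sub_roi Ix].
- exact: ideal_mulP.
Qed.

Lemma ideal_coprimeC (I J : set K) : ideal_coprime I J -> ideal_coprime J I.
Proof. by move=> [x [y [? ? xy]]]; exists y, x; rewrite addrC. Qed.

(** For x in q outside q', some power of x is 1 modulo q'. *)
Lemma place_coprime (q q' : finite_place K) : q <> q' ->
  ideal_coprime (place_ideal q) (place_ideal q').
Proof.
move=> qq'; have : ~ (forall x, place_ideal q x -> place_ideal q' x).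
  by move/place_maximal.
move/existsNP => [x /not_implyP[qx nq'x]]; have Ox := placeO qx.
have [m qm] := place_unit_order Ox nq'x.
exists (x ^+ m.+1), (- (x ^+ m.+1 - 1)); split; [|exact: placeN|by ring].
by rewrite exprS; apply: placeMr => //; exact: roiX.
Qed.

Lemma pprod_coprime (s t : seq (finite_place K)) :
  ideal_coprime (pprod s) (pprod t) <-> ~ exists2 q, q \in s & q \in t.
Proof.
split=> [[x [y [sx ty xy]]] [q qs qt]|st].
  apply: (@place_proper _ q); rewrite -xy.
  by apply: placeD; [exact: pprod_place sx|exact: pprod_place ty].
have unitr (I : set K) : ideal I -> ideal_coprime I O.
  by move=> [_ I0 _ _]; exists 0, 1; rewrite add0r; split=> //; exact: roi1.
have idq (q : finite_place K) := place_integral q.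
elim: s st => [|q s IH] st; first exact/ideal_coprimeC/unitr/ideal_pprod.
apply: ideal_coprimeC; apply: ideal_coprime_mulr;
  [exact: ideal_pprod|exact: idq|exact: ideal_pprod| |].
  have : q \notin t by apply/negP => qt; apply: st; exists q; rewrite ?mem_head.
  move=> qt; apply: ideal_coprimeC; elim: t qt {st IH} => [|q' t IH] /=.
    by move=> _; apply: unitr.
  rewrite inE negb_or => /andP[/eqP qq' qt].
  by apply: ideal_coprime_mulr; [exact: idq|exact: idq|exact: ideal_pprod| |];
    [exact: place_coprime|exact: IH].
apply: ideal_coprimeC; apply: IH => -[q' q's q't]; apply: st; exists q' => //.
by rewrite inE q's orbT.
Qed.

Lemma pprod_inj (s t : seq (finite_place K)) : uniq s -> uniq t ->
  s =i t -> pprod s = pprod t.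
Proof. by move=> us ut st; apply: ideal_prod_perm; apply: uniq_perm. Qed.

End Integers.

(** * Inertia acts trivially on a given number at almost all primes *)

Lemma algC_int_poly (x : algC) :
  exists2 p : {poly int}, p != 0 & root (map_poly intr p) x.
Proof.
have [q [Dq mq] _] := minCpolyP x.
have [p [a a0 E]] := rat_poly_scale q.
have p0 : p != 0.
  by apply: contraTneq mq => p0; rewrite E p0 rmorph0 scaler0 monicE lead_coef0 eq_sym oner_eq0.
exists p => //; have := root_minCpoly x; rewrite Dq E map_polyZ /= rootZ; last first.
  by rewrite fmorph_eq0 invr_eq0 intr_eq0.
by rewrite -map_poly_comp; congr (root _ _); apply: eq_map_poly => n /=; rewrite rmorph_int.
Qed.

Lemma algC_int_poly_neq0 (x : algC) : x != 0 ->
  exists2 p : {poly int}, p`_0 != 0 & root (map_poly intr p) x.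
Proof.
move=> x0; have [p] := algC_int_poly x.
elim/poly_ind: p => [|p c IH]; first by rewrite eqxx.
have [c0|c0] := eqVneq c 0; last first.
  by exists (p * 'X + c%:P) => //; rewrite coefD coefMX coefC /= add0r.
rewrite c0 addr0 => pX; rewrite rmorphM /= map_polyX rootM rootX (negPf x0) orbF.
by apply: IH; apply: contraNneq pX => ->; rewrite mul0r.
Qed.

(** The polynomial r is the reciprocal of p. *)
Lemma root_inv_reverse (F : fieldType) (p : {poly int}) (x : F) : x != 0 ->
  p`_0 != 0 -> root (map_poly intr p) x ->
  exists2 r : {poly int}, lead_coef r = p`_0 & root (map_poly intr r) x^-1.
Proof.
move=> x0 p0 px; pose r := \poly_(i < size p) p`_((size p).-1 - i).
have sp : (0 < size p)%N.
  by rewrite size_poly_gt0; apply: contraNneq p0 => ->; rewrite coef0.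
exists r; first by rewrite /r -{1}(prednK sp) lead_coef_poly // subnn.
have hp (s : {poly int}) y : (size s <= size p)%N ->
    (map_poly intr s).[y] = \sum_(i < size p) (s`_i)%:~R * y ^+ i :> F.
  move=> sz; rewrite (@horner_coef_wide _ (size p)) ?(leq_trans (size_poly _ _)) //.
  by apply: eq_bigr => i _; rewrite coef_map.
have /eqP : (map_poly intr p).[x] = 0 :> F by apply/eqP.
rewrite rootE !hp ?size_poly // => /eqP E; apply/eqP.
transitivity (x ^- (size p).-1 * \sum_(i < size p) (p`_i)%:~R * x ^+ i); last by rewrite E mulr0.
rewrite mulr_sumr [RHS](reindex_inj rev_ord_inj) /=; apply: eq_bigr => i _.
have ip : (i <= (size p).-1)%N by rewrite -ltnS (prednK sp).
have -> : (size p - i.+1 = (size p).-1 - i)%N by rewrite -subn1 -subnDA add1n.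
rewrite coef_poly ltn_ord mulrCA; congr (_ * _).
by rewrite exprVn -[X in x ^- X](subnK ip) exprD invfM -mulrA mulrCA mulVf ?mulr1 // expf_neq0.
Qed.

Section Local.
Variables (K : fieldExtType rat) (iota : {rmorphism K -> algC}).
Variables (q : finite_place K) (D : local_data iota q).
Local Notation F := (loc_field D).
Local Notation c := (loc_emb D).
Local Notation v := (@loc_val _ _ _ D).
Local Notation O := (loc_integers (D := D)).
Let cpl := loc_completion D.

Lemma val1 : v 1 = 0.
Proof.
have := Defs.valM cpl (oner_neq0 F) (oner_neq0 F); rewrite mulr1 => /esym/eqP.
by rewrite addrC -subr_eq0 addrK => /eqP.
Qed.

Lemma loc_int1 : O 1. Proof. by right; rewrite val1. Qed.

Lemma loc_intN1 : O (-1).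
Proof.
right; have N1 : (-1 : F) != 0 by rewrite oppr_eq0 oner_neq0.
have := Defs.valM cpl N1 N1; rewrite mulrNN mulr1 val1 => /esym E.
by rewrite -(pmulrn_lge0 (v (-1)) (n := 2)) // mulr2n E.
Qed.

Lemma loc_intD x y : O x -> O y -> O (x + y). Proof. exact: (Defs.valD cpl). Qed.

Lemma loc_intM x y : O x -> O y -> O (x * y).
Proof.
have [->|x0] := eqVneq x 0; first by left; rewrite mul0r.
have [->|y0] := eqVneq y 0; first by left; rewrite mulr0.
case=> [/eqP|vx]; first by rewrite (negPf x0).
case=> [/eqP|vy]; first by rewrite (negPf y0).
by right; rewrite (Defs.valM cpl) // addr_ge0.
Qed.

Lemma loc_int_intr (n : int) : O n%:~R.
Proof.
have roi_nat (m : nat) : O m%:R.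
  elim: m => [|m IH]; first by left.
  by rewrite mulrS; apply: loc_intD IH; exact: loc_int1.
case: n => n; first exact: roi_nat.
by rewrite NegzE rmorphN /= -mulN1r; apply: loc_intM; [exact: loc_intN1|exact: (roi_nat n.+1)].
Qed.

Lemma loc_unit (n : int) : ~ place_ideal q n%:~R -> (n%:~R != 0 :> F) /\ O n%:~R^-1.
Proof.
move=> nqn; have n0 : n%:~R != 0 :> K.
  by apply/eqP => n0; apply: nqn; rewrite n0; exact: place0.
have cn : c n%:~R = n%:~R by rewrite rmorph_int.
have cn0 : n%:~R != 0 :> F by rewrite -cn fmorph_eq0.
split=> //; right.
have v_ge := Defs.val_emb cpl (roi_int K n) n0 0%N.
have v_lt := Defs.val_emb cpl (roi_int K n) n0 1%N.
have vM := Defs.valM cpl cn0 (invr_neq0 cn0).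
rewrite mulfV // val1 in vM.
have vn_le : v n%:~R <= 0.
  rewrite leNgt; apply/negP => vn; apply: nqn.
  have /v_lt : 1%:Z <= v (c n%:~R) by rewrite cn.
  rewrite /ideal_exp /=; apply: (@ideal_mul_min K); first exact: place_integral.
  by move=> x y qx Oy; exact: placeMr.
have -> : v n%:~R^-1 = - v n%:~R by apply/eqP; rewrite -addr_eq0 addrC -vM.
by rewrite oppr_ge0.
Qed.

(** Away from the primes dividing its leading coefficient, an equation with integer
    coefficients can be made monic over the local integers. *)
Lemma loc_integral_int_poly (p : {poly int}) (z : loc_closure D) :
  ~ place_ideal q (lead_coef p)%:~R -> root (map_poly intr p) z -> loc_integral z.
Proof.
move=> /loc_unit[a0 Oa] pz; set a := (lead_coef p)%:~R in a0 Oa.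
exists (a^-1 *: map_poly intr p); split.
- rewrite monicE lead_coefZ lead_coef_map_eq ?mulVf //.
- by move=> n; rewrite coefZ coef_map; apply: loc_intM => //; exact: loc_int_intr.
- rewrite map_polyZ rootZ ?fmorph_eq0 ?invr_eq0 //= -map_poly_comp.
  congr (root _ _): pz; apply: eq_map_poly => n /=; rewrite rmorph_int //.
Qed.

Lemma decompE (s : Defs.gal (loc_incl D)) x :
  loc_closure_emb D (decomp s x) = s (loc_closure_emb D x).
Proof. exact: decomp_funE. Qed.

End Local.

Section Unramified.
Variables (K : fieldExtType rat) (iota : {rmorphism K -> algC}).
Variable D : forall q : finite_place K, local_data iota q.

Lemma finite_places_int (n : int) : n != 0 ->
  finite_set [set q : finite_place K | place_ideal q n%:~R].
Proof.
move=> n0; have := @finite_places_above K `|n|%N; rewrite absz_gt0 => /(_ n0).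
apply: sub_finite_set => q /=; case: n {n0} => n //.
by rewrite NegzE abszN rmorphN /= => /placeN; rewrite opprK.
Qed.

(** At a prime q not dividing the leading coefficient of an equation of x over the
    integers, the image of x in the local closure is integral. If inertia at q moves x to y,
    then y - x lies in the maximal ideal. By [root_inv_reverse] its inverse is
    integral unless q divides the constant term of an equation of y - x over the
    integers. So q divides one of finitely many nonzero integers, x having finitely many
    conjugates y. *)
Lemma almost_unramified (x : algC) :
  finite_set [set q | exists2 s, inertia (D q) s & decomp s x <> x].
Proof.
have [p p0 px] := algC_int_poly x.
have [rs rsP] := gal_conjugates iota x.
have /all_sig[P PP] (y : algC) : {r : {poly int} |
    y != x -> r`_0 != 0 /\ root (map_poly intr r) (y - x)}.
  apply: cid; have [->|yx] := eqVneq y x; first by exists 0.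
  by have [|r] := @algC_int_poly_neq0 (y - x); [rewrite subr_eq0|exists r].
pose B y := [set q : finite_place K | y != x /\ place_ideal q ((P y)`_0)%:~R].
apply: (@sub_finite_set _ _ ([set q : finite_place K | place_ideal q (lead_coef p)%:~R] `|`
    \bigcup_(y in [set` rs]) B y)); last first.
  rewrite finite_setU; split; first by apply: finite_places_int; rewrite lead_coef_eq0.
  apply: bigcup_finite; first exact: finite_seq.
  move=> y _; have [->|yx] := eqVneq y x.
    by apply: (sub_finite_set _ (finite_set0 _)) => q []; rewrite eqxx.
  apply: (sub_finite_set _ (finite_places_int (PP y yx).1)).
  by move=> q [].
move=> q [s sI /eqP sx]; have [|nqc] := pselect (place_ideal q (lead_coef p)%:~R); [by left|right].
exists (decomp s x); first exact: rsP.
split=> //; apply: contrapT => nqP.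
have [P0 Px] := PP _ sx; set e := loc_closure_emb (D q).
have d0 : decomp s x - x != 0 by rewrite subr_eq0.
have e_root (r : {poly int}) z : root (map_poly intr r) z -> root (map_poly intr r) (e z).
  by move=> rz; rewrite -(fmorph_root e) -map_poly_comp in rz;
     congr (root _ _): rz; apply: eq_map_poly => n /=; rewrite rmorph_int.
have ed0 : e (decomp s x - x) != 0 by rewrite fmorph_eq0.
have [r rlead rroot] := root_inv_reverse ed0 P0 (e_root _ _ Px).
have [_ []] := sI (e x) (loc_integral_int_poly nqc (e_root _ _ px)).
  by apply/eqP; rewrite -decompE -rmorphB.
apply; rewrite -decompE -rmorphB.
by apply: loc_integral_int_poly rroot; rewrite rlead.
Qed.

End Unramified.

(** * Characters, dual generators and primitive tuples *)

Section Coord.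
Variable l : nat.

Fixpoint mk_tower (r : nat) (a : nat -> 'F_l) : tower l r :=
  if r is k.+1 return tower l r then (a k, mk_tower k a) else tt.

Lemma coord_mk r a j : (j < r)%N -> Defs.coord j (mk_tower r a) = a j.
Proof.
elim: r => //= r IH; rewrite ltnS leq_eqVlt; case: eqVneq => [->//|_ /=].
exact: IH.
Qed.

Lemma coord1 r j : Defs.coord j (tower1 l r) = 0.
Proof. by elim: r => //= r IH; case: eqP. Qed.

Lemma coord_inj r (g h : tower l r) :
  (forall j, (j < r)%N -> Defs.coord j g = Defs.coord j h) -> g = h.
Proof.
elim: r g h => [[] []//|r IH] [a g] [b h] /= H.
have := H r (ltnSn r); rewrite eqxx => ->; congr pair; apply: IH => j jr.
by have := H j (ltnW jr); rewrite ltn_eqF.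
Qed.

End Coord.

Section Characters.
Variables (l : nat) (K : fieldExtType rat) (iota : {rmorphism K -> algC}).
Hypothesis l_pr : prime l.
Variable D : forall q : finite_place K, local_data iota q.
Variable B : generator_data l D.
Local Notation GK := (Defs.gal iota).
Local Notation GKl := (Defs.gal (prol_incl l iota)).
Local Notation ram := (ramifiable l D (clean B)).

Lemma sigma_ramE q : ram q ->
  exists2 s, inertia (D q) s & res l (decomp s) = sigma_ram B q.
Proof.
move=> rq; have : top_generated [set sigma_ram B q] (sigma_ram B q).
  exact: top_generated_sub.
by rewrite (sigma_ram_gen rq).
Qed.

(** The generator sigma_q comes from inertia at q, and f is constant on the
    automorphisms fixing a suitable finite set of algebraic numbers, which inertia
    at almost every prime does. *)
Lemma sigma_almost1 (T : Type) (f : GK -> T) : gal_continuous f -> factors_prol l f ->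
  finite_set [set q | ram q /\ descend f (sigma_ram B q) <> f 1%g].
Proof.
move=> cf ff; have [xs xsP] := continuous_at1 cf.
apply: (@sub_finite_set _ _ (\bigcup_(x in [set` xs])
  [set q | exists2 s, inertia (D q) s & decomp s x <> x])); last first.
  by apply: bigcup_finite; [exact: finite_seq|move=> x _; exact: almost_unramified].
move=> q [/sigma_ramE[s sI <-]]; rewrite descendE // => fs.
have : ~ {in xs, forall x, decomp s x = x} by move/xsP.
move=> /existsNP[x /not_implyP[xs_x sx]].
by exists x => //; exists s.
Qed.

(** The generators generate a dense subgroup. *)
Lemma H1_ext (f g : GK -> 'F_l) : H1 f -> H1 g ->
  (forall s, sigma_set B s -> descend f s = descend g s) -> f = g.
Proof.
move=> Hf Hg fg; have H := descend_H1 l_pr (H1_B Hf Hg).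
apply/funext => s; apply/eqP; rewrite -subr_eq0; apply/eqP.
have : top_generated (sigma_set B) (res l s) by rewrite sigma_gen.
move/(top_generated_min H) => E; rewrite -[RHS]E.
  by rewrite (descendE _ (H1_factors_prol l_pr (H1_B Hf Hg))).
by move=> t /fg; rewrite /descend !fctE => ->; rewrite subrr.
Qed.

Lemma chi_ker_H1 i : H1 (chi_ker B i).
Proof. by have [kerP _ _] := chi_ker_basis B; have [] := kerP i. Qed.

Lemma chi_ram_H1 q : ram q -> H1 (chi_ram B q).
Proof. by move=> /chi_ramP[]. Qed.

Lemma descend_sum (I : Type) (r : seq I) (P : pred I) (f : I -> GK -> 'F_l) (s : GKl) :
  descend (\sum_(i <- r | P i) f i) s = \sum_(i <- r | P i) descend (f i) s.
Proof. by rewrite /descend fct_sumE. Qed.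

Lemma descendD (f g : GK -> 'F_l) (s : GKl) :
  descend (f + g) s = descend f s + descend g s.
Proof. by []. Qed.

Lemma sum_pred_uniq (I : eqType) (s : seq I) (q : I) : uniq s ->
  \sum_(x <- s) (x == q)%:R = (q \in s)%:R :> 'F_l.
Proof.
elim: s => [|x s IH] /=; first by rewrite big_nil.
move=> /andP[xs us]; rewrite big_cons IH // inE [q == x]eq_sym.
by case: eqVneq xs => [->/negPf->|_ _]; rewrite ?addr0 ?add0r.
Qed.

Definition char_comb (s : seq (finite_place K)) (a : 'I_(chi_num B) -> 'F_l)
    (b : finite_place K -> 'F_l) : GK -> 'F_l :=
  \sum_i (a i \*o chi_ker B i) + \sum_(q <- s) (b q \*o chi_ram B q).

Lemma char_comb_H1 s a b : (forall q, q \in s -> ram q) -> H1 (char_comb s a b).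
Proof.
move=> sr; apply: H1_D; first by apply: H1_sum => i _; apply: H1_Z; exact: chi_ker_H1.
rewrite big_seq; apply: H1_sum => q qs; apply: H1_Z; apply: chi_ram_H1; exact: sr.
Qed.

Lemma char_comb_ker s a b i : (forall q, q \in s -> ram q) ->
  descend (char_comb s a b) (sigma_ker B i) = a i.
Proof.
move=> sr; rewrite descendD !descend_sum [X in _ + X]big_seq.
rewrite [X in _ + X]big1 => [|q qs]; last first.
  by have := dual_ram_ker i (sr q qs); rewrite /descend /= => ->; rewrite mulr0.
rewrite addr0 (bigD1 i) //= big1 => [|k ki].
  by have := dual_ker_ker (g := B) i i; rewrite /descend /= => ->; rewrite eqxx mulr1 addr0.
by have := dual_ker_ker (g := B) k i; rewrite /descend /= => ->; rewrite (negPf ki) mulr0.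
Qed.

Lemma char_comb_ram s a b q : uniq s -> (forall q, q \in s -> ram q) -> ram q ->
  descend (char_comb s a b) (sigma_ram B q) = if q \in s then b q else 0.
Proof.
move=> us sr rq; rewrite descendD !descend_sum big1 => [|i _]; last first.
  by have := dual_ker_ram i rq; rewrite /descend /= => ->; rewrite mulr0.
rewrite add0r big_seq (eq_bigr (fun x => b q * (x == q)%:R)) => [|x xs]; last first.
  have := dual_ram_ram (sr x xs) rq; rewrite /descend /= => ->.
  by case: eqVneq => [->//|_]; rewrite !mulr0.
rewrite -big_seq -mulr_sumr sum_pred_uniq //.
by case: ifP; rewrite ?mulr1 ?mulr0.
Qed.

Lemma finite_ram_seq (P : finite_place K -> Prop) : finite_set [set q | ram q /\ P q] ->
  exists s, [/\ uniq s, forall q, q \in s -> ram q & forall q, q \in s <-> ram q /\ P q].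
Proof.
move/finite_seqP => [s Es]; exists (undup s).
have H q : q \in undup s <-> ram q /\ P q.
  rewrite mem_undup; have <- : [set` s] q = (q \in s) by [].
  by rewrite -Es.
split=> //; first exact: undup_uniq.
by move=> q /H[].
Qed.

(** A finite combination of the dual characters, with the prescribed values as
    coefficients. *)
Lemma prescribed_character (a : 'I_(chi_num B) -> 'F_l) (b : finite_place K -> 'F_l) :
    finite_set [set q | ram q /\ b q <> 0] ->
  exists chi, [/\ H1 chi, forall i, descend chi (sigma_ker B i) = a i
    & forall q, ram q -> descend chi (sigma_ram B q) = b q].
Proof.
move/finite_ram_seq=> [s [us sr sP]]; exists (char_comb s a b).
split; [exact: char_comb_H1|by move=> i; exact: char_comb_ker|move=> q rq].
rewrite char_comb_ram //; case: ifPn => // /negP qs.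
apply/esym; apply: contrapT => bq; apply: qs; apply/sP; by split.
Qed.

(** The characters of B(K,l), as well as the dual generators, are indexed by the
    elements of [t] and by places. A pair (T, b) amounts to a finite set of
    indices: those of the characters whose sum is chi_(T,b). *)
Definition in_support (t : 'I_(chi_num B) + finite_place K) (p : Spair B) : bool :=
  match t with inl i => p.1 i | inr q => `[< ideal_dvd (place_ideal q) p.2 >] end.

Definition is_index (t : 'I_(chi_num B) + finite_place K) : Prop :=
  if t is inr q then ram q else True.

Definition sigma_at (t : 'I_(chi_num B) + finite_place K) : GKl :=
  match t with inl i => sigma_ker B i | inr q => sigma_ram B q end.

Lemma sigma_setP s : sigma_set B s -> exists2 t, is_index t & sigma_at t = s.
Proof.
by case=> [[i _ <-]|[q rq <-]]; [exists (inl i)|exists (inr q)].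
Qed.

Lemma SlP (p : Spair B) : Sl p ->
  exists s, [/\ uniq s, forall q, q \in s -> ram q,
    p.2 = ideal_prod (map (@place_ideal K) s) & forall q, in_support (inr q) p = (q \in s)].
Proof.
move=> [s [us sr Ep]]; exists s; split=> // q.
apply/asboolP/idP; rewrite Ep => /ideal_dvd_pprod //.
Qed.

Lemma chi_pairE (p : Spair B) s : uniq s -> (forall q, in_support (inr q) p = (q \in s)) ->
  chi_pair p = char_comb s (fun i => (p.1 i)%:R) (fun=> 1).
Proof.
move=> us sP; rewrite /chi_pair /char_comb; congr (_ + _).
  rewrite big_mkcond; apply: eq_bigr => i _; apply/funext => x.
  by case: (p.1 i); rewrite /= ?mul1r ?mul0r.
have -> : [set q : finite_place K | ideal_dvd (place_ideal q) p.2] = [set` s].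
  apply/seteqP; split=> q /=; rewrite -sP; first by move=> ?; apply/asboolP.
  by move/asboolP.
rewrite -fsbig_seq //; apply: eq_bigr => q _; apply/funext => x.
by rewrite /= mul1r.
Qed.

Lemma chi_pair_H1 (p : Spair B) : Sl p -> H1 (chi_pair p).
Proof. by move=> /SlP[s [us sr _ sP]]; rewrite (chi_pairE us sP); apply: char_comb_H1. Qed.

(** Evaluated at the dual generators, chi_(T,b) is the indicator function of the
    support of (T, b). *)
Lemma chi_pair_sigma (p : Spair B) t : Sl p -> is_index t ->
  descend (chi_pair p) (sigma_at t) = (in_support t p)%:R.
Proof.
move=> /SlP[s [us sr _ sP]]; rewrite (chi_pairE us sP).
case: t => [i _|q rq]; first by rewrite char_comb_ker.
by rewrite char_comb_ram // sP; case: ifP.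
Qed.

Lemma support_inj (p p' : Spair B) : Sl p -> Sl p' ->
  (forall t, is_index t -> in_support t p = in_support t p') -> p = p'.
Proof.
move=> /SlP[s [us sr Ep sP]] /SlP[s' [us' sr' Ep' sP']] pp'.
rewrite [p]surjective_pairing [p']surjective_pairing; congr pair.
  by apply/ffunP => i; exact: (pp' (inl i)).
rewrite Ep Ep'; apply: pprod_inj => // q; apply/idP/idP => qs.
  by rewrite -sP' -pp' ?sP //; exact: sr.
by rewrite -sP pp' ?sP' //; exact: sr'.
Qed.

Lemma pair_coprimeP (p p' : Spair B) : Sl p -> Sl p' ->
  pair_coprime p p' <-> forall t, ~ (in_support t p /\ in_support t p').
Proof.
move=> /SlP[s [us sr Ep sP]] /SlP[s' [us' sr' Ep' sP']].
rewrite /pair_coprime Ep Ep' pprod_coprime; split=> [[ss' pp'] [i|q] []|H].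
- by move=> pi p'i; apply: pp'; exists i.
- by rewrite sP sP' => qs qs'; apply: ss'; exists q.
- split=> [[q qs qs']|[i pi]]; last exact: (H (inl i)).
  by apply: (H (inr q)); rewrite sP sP'.
Qed.

Section Pow.
Variable r : nat.
Local Notation T := (tower l r).

(** Supports in a primitive tuple are disjoint, so at most one coordinate g has t in
    its support. The value 1 of the group stands for no coordinate; in this way
    primitive tuples become functions with finite support from the indices to G. *)
Definition sigma_value (v : non_id l r -> Spair B) t : T :=
  if [pick g | in_support t (v g)] is Some g then val g else tower1 l r.

Lemma in_support_sigma_value v t g : Prim B r v ->
  in_support t (v g) = (sigma_value v t == val g).
Proof.
move=> [vS vC]; rewrite /sigma_value; case: pickP => [h ht|no]; last first.
  by rewrite no eq_sym (negPf (valP g)).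
apply/idP/eqP => [gt|/val_inj <- //]; congr val.
apply/eqP/negPn/negP => hg; have /pair_coprimeP H := vC _ _ hg.
by apply: (H _ _ t) => //.
Qed.

Lemma Pow_H1 (v : non_id l r -> Spair B) j : Prim B r v -> H1 (Pow v j).
Proof.
by move=> [vS _]; apply: H1_sum => g _; apply: H1_Z; apply: chi_pair_H1.
Qed.

(** In the sum defining the j-th character only the coordinate whose support contains
    t contributes, with the coefficient pi_j of its index. *)
Lemma Pow_sigma (v : non_id l r -> Spair B) j t : Prim B r v -> is_index t ->
  descend (Pow v j) (sigma_at t) = Defs.coord j (sigma_value v t).
Proof.
move=> Pv gt; rewrite descend_sum.
rewrite (eq_bigr (fun g : non_id l r =>
  Defs.coord j (val g) * (sigma_value v t == val g)%:R)) => [|g _]; last first.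
  rewrite -in_support_sigma_value // -chi_pair_sigma //.
  by case: Pv.
have [u0|u0] := eqVneq (sigma_value v t) (tower1 l r).
  by rewrite u0 coord1 big1 // => g _; rewrite eq_sym (negPf (valP g)) mulr0.
rewrite (bigD1 (exist (fun g : T => g != tower1 l r) _ u0)) //= eqxx mulr1 big1 ?addr0 // => g ne.
case: eqP => [E|_]; last by rewrite mulr0.
by case/eqP: ne; apply: val_inj.
Qed.

Lemma Pow_inj (v v' : non_id l r -> Spair B) : Prim B r v -> Prim B r v' ->
  (forall j, (j < r)%N -> Pow v j = Pow v' j) -> v = v'.
Proof.
move=> Pv Pv' vv'; apply/funext => g; have [vS _] := Pv; have [vS' _] := Pv'.
apply: support_inj => // t gt; rewrite !in_support_sigma_value //; congr (_ == _).
by apply: coord_inj => j jr; rewrite -!Pow_sigma // vv'.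
Qed.

(** Let v_g have as support the generators at which the values of the characters w_j
    are the coordinates of g. The support is finite because g is not the identity
    and each w_j vanishes at almost all the generators coming from inertia. *)
Lemma Pow_surj (w : nat -> GK -> 'F_l) : (forall j, (j < r)%N -> H1 (w j)) ->
  exists2 v : non_id l r -> Spair B, Prim B r v & forall j, (j < r)%N -> Pow v j = w j.
Proof.
move=> wH; pose u t : T := mk_tower r (fun j => descend (w j) (sigma_at t)).
have fin : finite_set [set q | ram q /\ u (inr q) <> tower1 l r].
  apply: (@sub_finite_set _ _ (\bigcup_(j in [set j : nat | (j < r)%N])
      [set q | ram q /\ descend (w j) (sigma_ram B q) <> w j 1%g])).
    move=> q [rq uq].
    have : ~ forall j, (j < r)%N -> Defs.coord j (u (inr q)) = Defs.coord j (tower1 l r).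
      by move/coord_inj.
    move=> /existsNP[j /not_implyP[jr ne]]; exists j => //; split=> // E; apply: ne.
    by rewrite coord_mk // coord1 [LHS]E H1_1 //; exact: wH.
  apply: bigcup_finite; first exact: finite_II.
  move=> j jr; have Hj := wH j jr; apply: sigma_almost1; first by case: Hj.
  exact: H1_factors_prol.
have [s [us sr sP]] := finite_ram_seq fin.
pose sg (g : T) := [seq q <- s | u (inr q) == g].
pose v (g : non_id l r) : Spair B :=
  ([ffun i => u (inl i) == val g], ideal_prod (map (@place_ideal K) (sg (val g)))).
have vS g : Sl (v g).
  exists (sg (val g)); split=> //; first exact: filter_uniq.
  by move=> q; rewrite mem_filter => /andP[_ /sr].
have vP t g : is_index t -> in_support t (v g) = (u t == val g).
  case: t => [i _|q rq] /=; first by rewrite ffunE.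
  apply/asboolP/eqP => [/ideal_dvd_pprod|uq]; first by rewrite mem_filter => /andP[/eqP].
  apply/ideal_dvd_pprod; rewrite mem_filter uq eqxx; apply/sP; split=> //.
  by rewrite uq; apply/eqP; exact: valP g.
have Pv : Prim B r v.
  split=> // g h gh; apply/pair_coprimeP => // t.
  have [gt|ngt] := pselect (is_index t).
    by rewrite !vP // => -[/eqP -> /eqP /val_inj E]; rewrite E eqxx in gh.
  case: t ngt => [i|q] //= nrq [/asboolP/ideal_dvd_pprod + _].
  by rewrite mem_filter => /andP[_ /sr].
exists v => // j jr; apply: H1_ext; [exact: Pow_H1|exact: wH|].
move=> _ /sigma_setP[t gt <-]; rewrite Pow_sigma //.
have -> : sigma_value v t = u t; last by rewrite coord_mk.
have [u1|u1] := eqVneq (u t) (tower1 l r).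
  rewrite /sigma_value; case: pickP => [g|_ //]; rewrite vP // u1 eq_sym.
  by rewrite (negPf (valP g)).
pose g : non_id l r := exist (fun g : T => g != tower1 l r) _ u1.
by apply/eqP; have := in_support_sigma_value t g Pv; rewrite vP // eqxx => <-.
Qed.

End Pow.
End Characters.

(** * Towers of central extensions *)

Section Tower.
Variable l : nat.
Hypothesis l_pr : prime l.
Variable theta : forall i, tower l i -> tower l i -> 'F_l.
Local Notation mul := (@tower_mul l theta _).
Local Notation one := (tower1 l _).

Lemma admissibleW i r : (i <= r)%N -> admissible theta r -> admissible theta i.
Proof. by move=> ir adm j ji; apply: adm; apply: leq_trans ir. Qed.

Lemma tower_mulS i (a b : 'F_l) (g h : tower l i) :
  tower_mul theta ((a, g) : tower l i.+1) ((b, h) : tower l i.+1) =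
  (a + b + theta g h, mul g h).
Proof. by []. Qed.

Lemma tower1S i : tower1 l i.+1 = (0, tower1 l i). Proof. by []. Qed.

Lemma tower_eta i (x : tower l i.+1) : exists (a : 'F_l) (g : tower l i), x = (a, g).
Proof. by case: x => a g; exists a, g. Qed.

Lemma tower_mul1_theta i : admissible theta i ->
  [/\ forall g : tower l i, mul one g = g, forall g : tower l i, mul g one = g
    & forall j, (j < i)%N -> forall g : tower l j, theta one g = 0 /\ theta g one = 0].
Proof.
elim: i => [_|i IH adm]; first by split=> [[]|[]|].
have [m1 m1r th] := IH (admissibleW (leqnSn i) adm).
have [cocy th11 _] := adm i (ltnSn i).
have th1 (g : tower l i) : theta one g = 0 /\ theta g one = 0.
  split.
    have := cocy one one g; rewrite !m1 th11 add0r => /eqP.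
    by rewrite -subr_eq0 opprD addrA subrr sub0r oppr_eq0 => /eqP.
  have := cocy g one one; rewrite !m1r th11 add0r => /eqP.
  by rewrite -subr_eq0 addrK => /eqP.
split=> [x|x|j].
- by have [a [g ->]] := tower_eta x; rewrite tower1S tower_mulS m1 (th1 g).1 add0r addr0.
- by have [a [g ->]] := tower_eta x; rewrite tower1S tower_mulS m1r (th1 g).2 !addr0.
- by rewrite ltnS leq_eqVlt => /predU1P[->|/th].
Qed.

Lemma tower_mul_cancel i (x y z : tower l i) : mul x y = mul x z -> y = z.
Proof.
elim: i x y z => [[] [] []//|i IH] x y z.
have [a [g ->]] := tower_eta x; have [b [h ->]] := tower_eta y.
have [c [k ->]] := tower_eta z; rewrite !tower_mulS => E.
have := congr1 snd E => /= /IH E2; move: (congr1 fst E); rewrite E2 /fst.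
by move/addIr/addrI ->.
Qed.

Lemma Fl_linear (f : 'F_l -> 'F_l) : {morph f : a b / a + b} -> forall a, f a = a * f 1.
Proof.
move=> fD a; have f0 : f 0 = 0 by apply: (addrI (f 0)); rewrite -fD !addr0.
have fn n : f n%:R = n%:R * f 1.
  by elim: n => [|n IH]; rewrite ?mul0r // !mulrS fD IH mulrDl mul1r.
by rewrite -(natr_Zp a) fn.
Qed.

(** The Frattini quotient of G_i is spanned by the coordinates adjoined along the
    trivial extensions: a homomorphism to F_l that does not vanish on the kernel of
    G_(j+1) -> G_j splits this extension. *)
Lemma tower_hom_span i (u : tower l i -> 'F_l) : admissible theta i ->
  {morph u : g h / mul g h >-> g + h} ->
  exists a : nat -> 'F_l, forall g, u g = \sum_(j < i | theta_zero theta j) a j * Defs.coord j g.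
Proof.
elim: i u => [|i IH] u adm uM.
  exists (fun=> 0) => -[]; rewrite big_ord0; apply: (addrI (u tt)).
  by rewrite -(uM tt tt) addr0.
have admi := admissibleW (leqnSn i) adm.
have [m1 m1r _] := tower_mul1_theta admi.
have [_ _ th] := tower_mul1_theta adm; have th1 := th i (ltnSn i).
pose c := u (1, one); pose v (g : tower l i) := u (0, g).
have uE (a : 'F_l) (g : tower l i) : u (a, g) = a * c + v g.
  rewrite -(Fl_linear (f := fun a => u (a, one))) => [|x y]; rewrite -uM /=.
    by rewrite m1 (th1 g).1 !addr0.
  by rewrite m1 (th1 one).1 addr0.
have vM g h : theta g h * c + v (mul g h) = v g + v h.
  by rewrite -uE -uM /= !add0r.
have IHv : (forall g h : tower l i, theta g h * c = 0) -> exists a : nat -> 'F_l,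
    forall g, v g = \sum_(j < i | theta_zero theta j) a j * Defs.coord j g.
  by move=> c0; apply: (IH v admi) => g h; rewrite -vM c0 add0r.
have [i0|i0] := boolP (theta_zero theta i).
  have [|a aE] := IHv.
    by move=> g h; rewrite (eqP (forallP (forallP i0 g) h)) mul0r.
  exists (fun j => if j == i then c else a j) => x.
  have [b [g ->]] := tower_eta x; rewrite uE aE.
  rewrite [RHS]big_mkcond big_ord_recr /= eqxx i0 addrC mulrC; congr (_ + _).
  rewrite big_mkcond; apply: eq_bigr => j _; case: ifP => // _.
  by rewrite ltn_eqF.
have c0 : c = 0.
  apply: contraNeq i0 => c0; have [_ _ ->] := adm i (ltnSn i).
  exists (fun g => - (v g) / c) => g h; apply: (mulIf c0).
  rewrite !mulrBl !mulfVK // !opprK.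
  have := vM g h; move/(canRL (addrK _)) ->.
  by rewrite addrC addrA.
have [|a aE] := IHv; first by move=> g h; rewrite c0 mulr0.
exists a => x; have [b [g ->]] := tower_eta x; rewrite uE c0 mulr0 add0r aE.
rewrite [RHS]big_mkcond big_ord_recr /= (negPf i0) addr0 big_mkcond.
apply: eq_bigr => j _; case: ifP => // _.
by rewrite ltn_eqF.
Qed.

End Tower.

(** * Solving the embedding problems *)

Section Embedding.
Variables (l : nat) (K : fieldExtType rat) (iota : {rmorphism K -> algC}).
Hypothesis l_pr : prime l.
Variable D : forall q : finite_place K, local_data iota q.
Variable B : generator_data l D.
Variable theta : forall i, tower l i -> tower l i -> 'F_l.
Local Notation GK := (Defs.gal iota).
Local Notation GKl := (Defs.gal (prol_incl l iota)).
Local Notation mul := (@tower_mul l theta _).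
Local Notation one := (tower1 l _).

Definition tower_hom i (psi : GKl -> tower l i) := 
  gal_continuous psi /\ {morph psi : s t / (s * t)%g >-> tower_mul theta s t}.

Lemma tower_hom1 i (psi : GKl -> tower l i) : admissible theta i ->
  tower_hom psi -> psi 1%g = tower1 l i.
Proof.
move=> adm [_ psiM]; have [_ m1r _] := tower_mul1_theta adm.
by apply: (@tower_mul_cancel _ theta _ (psi 1%g)); rewrite m1r -psiM mulg1.
Qed.

Lemma tower_hom_snd i (psi : GKl -> tower l i.+1) : tower_hom psi ->
  tower_hom (fun s => (psi s).2 : tower l i) /\
  (gal_continuous (fun s => (psi s).1) /\
   forall s t, (psi (s * t)%g).1 = (psi s).1 + (psi t).1 + theta (psi s).2 (psi t).2).
Proof.
move=> [cpsi psiM]; split.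
  by split=> [|s t]; [exact: (continuous_comp snd cpsi)|rewrite psiM].
by split=> [|s t]; [exact: (continuous_comp fst cpsi)|rewrite psiM].
Qed.

(** The group G_i has exponent dividing l^i. *)
Lemma tower_hom_exponent i (psi : GKl -> tower l i) s : admissible theta i ->
  tower_hom psi -> psi (s ^+ (l ^ i))%g = tower1 l i.
Proof.
elim: i psi s => [|i IH] psi s adm hpsi; first by case: (psi _).
have [hpsi2 [_ psi1M]] := tower_hom_snd hpsi.
have admi := admissibleW (leqnSn i) adm.
have [_ _ th] := tower_mul1_theta adm.
rewrite expnSr expgM; set t := (s ^+ _)%g.
have t2 : (psi t).2 = tower1 l i by exact: (IH _ s admi hpsi2).
have psi1 := tower_hom1 adm hpsi.
have H n : psi (t ^+ n)%g = ((psi t).1 *+ n, tower1 l i) :> tower l i.+1.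
  elim: n => [|n IHn]; first by rewrite expg0 psi1.
  have [_ psiM] := hpsi; rewrite expgSr psiM IHn.
  have [m1 _ _] := tower_mul1_theta admi.
  have [a [g E]] := tower_eta (psi t); rewrite E in t2 *.
  rewrite (_ : g = tower1 l i) // tower_mulS m1 (th i (ltnSn i) _).1 addr0.
  by rewrite mulrSr.
by rewrite H; congr pair; exact: mulrn_pchar (pchar_Fp l_pr) _.
Qed.

Lemma cobounds_factors_prol i (psi : GKl -> tower l i) (phi : GK -> 'F_l) :
  admissible theta i.+1 -> tower_hom psi -> gal_continuous phi ->
  cobounds phi (pullback theta psi) -> factors_prol l phi.
Proof.
move=> adm hpsi cphi dphi; have admi := admissibleW (leqnSn i) adm.
have [_ _ th] := tower_mul1_theta adm; have thi := th i (ltnSn i).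
have [m1 m1r _] := tower_mul1_theta admi.
have psi1 := tower_hom1 admi hpsi; have [cpsi psiM] := hpsi.
have dphiE s t : phi (s * t)%g = phi s + phi t + theta (psi (res l s)) (psi (res l t)).
  by have := dphi s t; rewrite /pullback => <-; ring.
have [xs xsP] := continuous_at1 (res_continuous cpsi).
pose N := [set s : GK | psi (res l s) = tower1 l i].
apply: (@cochain_factors_prol l K iota l_pr phi N xs i) => //.
- split=> [|s t Ns Nt|s Ns]; rewrite /N /=; first by rewrite res1.
    by rewrite resM psiM Ns Nt m1.
  apply: (@tower_mul_cancel _ theta _ (psi (res l s))).
  by rewrite -psiM -resM mulgV res1 psi1 Ns m1.
- move=> s t Ns; rewrite /N /= !resM !psiM Ns m1r -psiM -resM mulgV res1.
  exact: psi1.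
- by move=> s /xsP; rewrite /N /= => ->; rewrite res1.
- move=> s; rewrite /N /=.
  have -> : res l (s ^+ (l ^ i))%g = (res l s ^+ (l ^ i))%g.
    by elim: (l ^ i)%N => [|n IH]; rewrite ?res1 // !expgS resM IH.
  exact: tower_hom_exponent.
- by move=> s t Ns; rewrite dphiE Ns (thi _).2 addr0.
- by move=> s t Ns; rewrite dphiE Ns (thi _).1 addr0.
Qed.

Lemma cobounds_1 i (psi : GKl -> tower l i) (phi : GK -> 'F_l) :
  admissible theta i.+1 -> tower_hom psi -> cobounds phi (pullback theta psi) ->
  phi 1%g = 0.
Proof.
move=> adm hpsi /(_ 1%g 1%g); rewrite /pullback res1 (tower_hom1 _ hpsi).
  have [_ _ th] := tower_mul1_theta adm; rewrite (th i (ltnSn i) _).1 mulg1.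
  by rewrite subrr sub0r => /eqP; rewrite oppr_eq0 => /eqP.
exact: admissibleW (leqnSn i) adm.
Qed.

(** A cochain phi trivializing the pullback need not vanish on the generators, but
    the character with the same values on them can be subtracted from it. This
    character exists because phi, like a character, vanishes at almost all the
    generators coming from inertia. *)
Lemma normalized_cochainP i (psi : GKl -> tower l i) :
  admissible theta i.+1 -> tower_hom psi -> H2_trivial (pullback theta psi) ->
  [/\ gal_continuous (normalized_cochain B theta psi),
     cobounds (normalized_cochain B theta psi) (pullback theta psi)
   & forall s, sigma_set B s -> descend (normalized_cochain B theta psi) s = 0].
Proof.
move=> adm hpsi [phi cphi dphi].
apply: (@xgetPex _ 0 [set phi : GK -> 'F_l |
    [/\ gal_continuous phi, cobounds phi (pullback theta psi)
     & forall s, sigma_set B s -> descend phi s = 0]]).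
have fphi := cobounds_factors_prol adm hpsi cphi dphi.
have phi1 := cobounds_1 adm hpsi dphi.
have [|chi [Hchi chi_ker chi_ram]] := @prescribed_character l K iota D B
   (fun i => descend phi (sigma_ker B i)) (fun q => descend phi (sigma_ram B q)).
  by rewrite -phi1; exact: sigma_almost1.
exists (phi - chi); split=> [|s t|_ /sigma_setP[t gt <-]].
- exact: (continuous_comp2 (fun a b => a - b) cphi Hchi.1).
- by rewrite -dphi !fctE Hchi.2; ring.
- have E : descend phi (sigma_at t) = descend chi (sigma_at t).
    by case: t gt => [k|q] /= gt; rewrite ?chi_ker ?chi_ram.
  by move: E; rewrite /descend !fctE => ->; rewrite subrr.
Qed.

End Embedding.

Section PtildeTheory.
Variables (l : nat) (K : fieldExtType rat) (iota : {rmorphism K -> algC}).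
Hypothesis l_pr : prime l.
Variable D : forall q : finite_place K, local_data iota q.
Variable B : generator_data l D.
Variable theta : forall i, tower l i -> tower l i -> 'F_l.
Local Notation GK := (Defs.gal iota).
Local Notation GKl := (Defs.gal (prol_incl l iota)).

Lemma Epi_hom i (psi : GKl -> tower l i) : Epi iota theta i psi -> tower_hom theta psi.
Proof. by case. Qed.

(** If f is not a function of psi, some k in the kernel of psi has f k nonzero, and
    multiplication by the powers of k takes f through all of F_l on the fibre of
    psi over any g. *)
Lemma surj_or_graph i (psi : GKl -> tower l i) (f : GKl -> 'F_l) :
  admissible theta i.+1 -> Epi iota theta i psi ->
  (forall s t, f (s * t)%g = f s + f t + theta (psi s) (psi t)) ->
  (forall a g, exists2 s, f s = a & psi s = g) \/
  (exists u : tower l i -> 'F_l, forall s, f s = u (psi s)).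
Proof.
move=> adm [_ psiM psi_surj] fM; have [_ _ th] := tower_mul1_theta adm.
have [_ m1r _] := tower_mul1_theta (admissibleW (leqnSn i) adm).
have [H|] := pselect (forall s t, psi s = psi t -> f s = f t).
  right; have /all_sig[h hP] (g : tower l i) := cid (psi_surj g).
  by exists (f \o h) => s /=; apply: H; rewrite hP.
move=> /existsNP[s /existsNP[t /not_implyP[st fst]]]; left=> a g.
pose k := (s^-1 * t)%g; have tE : t = (s * k)%g by rewrite /k mulKVg.
have k1 : psi k = tower1 l i.
  apply: (@tower_mul_cancel _ theta _ (psi s)).
  by rewrite -psiM -tE m1r.
have fX u n : f (u * k ^+ n)%g = f u + f k *+ n /\ psi (u * k ^+ n)%g = psi u.
  elim: n => [|n [IH1 IH2]]; first by rewrite expg0 mulg1 addr0.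
  rewrite expgSr mulgA fM (psiM (u * k ^+ n)%g) IH1 IH2 k1 m1r (th i (ltnSn i) _).2 addr0.
  by rewrite mulrSr addrA.
have fk0 : f k != 0.
  apply/eqP => fk0; apply: fst.
  by rewrite tE fM k1 fk0 (th i (ltnSn i) _).2 !addr0.
have [u ug] := psi_surj g; pose n : nat := (a - f u) / f k.
exists (u * k ^+ n)%g; have [E1 E2] := fX u n; last by rewrite E2.
by rewrite E1 -mulr_natr natr_Zp mulrC divfK // addrC subrK.
Qed.

Lemma theta_zeroP i : theta_zero theta i -> forall g h : tower l i, theta g h = 0.
Proof. by move=> /forallP i0 g h; apply/eqP/(forallP (i0 g)). Qed.

Lemma Ptilde_ext (w w' : nat -> GK -> 'F_l) i :
  (forall j, (j < i)%N -> w j = w' j) -> Ptilde B theta w i = Ptilde B theta w' i.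
Proof.
elim: i => //= i IH ww'; rewrite IH => [|j ji]; last exact: ww' (ltnW ji).
have Ei : w i = w' i by exact: ww'.
have Es : in_span theta w i = in_span theta w' i.
  rewrite /in_span Ei; apply/propext; split=> -[a ->]; exists a; apply: eq_bigr => j _;
  by rewrite ww' //; exact: (leqW (ltn_ord j)).
by rewrite Ei Es.
Qed.

(** By [surj_or_graph] the lift is onto unless it is given by a function u on G_i. For
    a trivial extension u is a homomorphism, so [tower_hom_span] makes w_(i+1) a
    combination of the earlier split characters, which the construction rules out.
    Otherwise theta_(i+1) is the coboundary of u, hence zero by admissibility. The
    second conclusion identifies the split characters with coordinates of psi. *)
Lemma Ptilde_Epi (w : nat -> GK -> 'F_l) i psi : admissible theta i ->
  (forall j, (j < i)%N -> H1 (w j)) -> Ptilde B theta w i = Some psi ->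
  Epi iota theta i psi /\ forall j, (j < i)%N -> theta_zero theta j ->
    forall s, Defs.coord j (psi (res l s)) = w j s.
Proof.
elim: i psi => [|i IH] psi adm wH.
  by move=> [<-]; split=> //; split=> [|//|[]]; [exact: continuous_cst|exists 1%g].
have admi := admissibleW (leqnSn i) adm.
rewrite [Ptilde _ _ _ _]/=; case Ei : (Ptilde B theta w i) => [psi'|] //.
have [epi coordP] := IH psi' admi (fun j ji => wH j (ltnW ji)) Ei.
have hpsi := Epi_hom epi; have [cpsi psiM psi_surj] := epi.
have Hi := wH i (ltnSn i).
case: asboolP => // /contrapT triv.
case: (boolP (theta_zero theta i)) => i0.
  case: asboolP => // nspan [<-].
  have fi := H1_factors_prol l_pr Hi; have [fc fM] := descend_H1 l_pr Hi.
  split; last first.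
    move=> j; rewrite ltnS leq_eqVlt => /predU1P[->|ji] j0 s /=.
      by rewrite eqxx descendE.
    by rewrite ltn_eqF //; exact: coordP.
  split.
  - exact: (continuous_comp2 (fun a g => (a, g)) fc cpsi).
  - move=> s t; rewrite tower_mulS psiM fM.
    by rewrite (theta_zeroP i0) addr0.
  move=> x; have [a [g ->]] := tower_eta x.
  have [|S|[u uE]] := surj_or_graph (f := descend (w i)) adm epi.
  - by move=> s t; rewrite fM (theta_zeroP i0) addr0.
  - by have [s <- <-] := S a g; exists s.
  case: nspan; have [|c cE] := tower_hom_span (u := u) admi.
    move=> g1 g2; have [s <-] := psi_surj g1; have [t <-] := psi_surj g2.
    by rewrite -psiM -!uE fM.
  exists c; apply/funext => s; rewrite fct_sumE.
  have := uE (res l s); rewrite descendE // => ->; rewrite cE.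
  by apply: eq_bigr => j j0 /=; rewrite coordP.
have [nc nd _] := normalized_cochainP l_pr B adm hpsi triv.
set nu := normalized_cochain B theta psi' in nc nd *; move=> [<-].
pose phi := nu + w i.
have cphi : gal_continuous phi by apply: (continuous_comp2 +%R nc); case: Hi.
have dphi : cobounds phi (pullback theta psi').
  by move=> s t; rewrite -nd /phi !fctE Hi.2; ring.
have fphi := cobounds_factors_prol l_pr adm hpsi cphi dphi.
have fM s t : descend phi (s * t)%g = descend phi s + descend phi t + theta (psi' s) (psi' t).
  rewrite -(res_liftK s) -(res_liftK t) -resM !descendE // -[theta _ _]/(pullback theta psi' _ _).
  by rewrite -dphi; ring.
split; last first.
  move=> j; rewrite ltnS leq_eqVlt => /predU1P[->|ji] j0 s; first by rewrite j0 in i0.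
  by rewrite /= ltn_eqF //; exact: coordP.
split.
- exact: (continuous_comp2 (fun a g => (a, g)) fphi.2 cpsi).
- by move=> s t; rewrite tower_mulS psiM fM.
move=> x; have [a [g ->]] := tower_eta x.
have [//|S|[u uE]] := surj_or_graph (f := descend phi) adm epi.
  by have [s <- <-] := S a g; exists s.
have [_ _ i0P] := adm i (ltnSn i); case/negP: i0; apply/i0P.
exists u => g1 g2; have [s <-] := psi_surj g1; have [t <-] := psi_surj g2.
by rewrite -psiM -!uE fM; ring.
Qed.

(** The cochain added to w_(i+1) depends only on psi_i, so the coordinates of psi
    determine the characters one after the other. *)
Lemma Ptilde_inj (w w' : nat -> GK -> 'F_l) i psi : admissible theta i ->
  (forall j, (j < i)%N -> H1 (w j)) -> (forall j, (j < i)%N -> H1 (w' j)) ->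
  Ptilde B theta w i = Some psi -> Ptilde B theta w' i = Some psi ->
  forall j, (j < i)%N -> w j = w' j.
Proof.
elim: i psi => // i IH psi adm wH wH'.
have admi := admissibleW (leqnSn i) adm.
rewrite ![Ptilde _ _ _ i.+1]/=.
case Ei : (Ptilde B theta w i) => [psi1|] //; case Ei' : (Ptilde B theta w' i) => [psi2|] //.
have [epi _] := Ptilde_Epi admi (fun j ji => wH j (ltnW ji)) Ei.
have descend_inj (f g : GK -> 'F_l) : H1 f -> H1 g -> descend (l := l) f = descend g -> f = g.
  move=> Hf Hg fg; apply/funext => s.
  by rewrite -(descendE s (H1_factors_prol l_pr Hf)) fg descendE //; exact: H1_factors_prol.
have wHi := wH i (ltnSn i); have wHi' := wH' i (ltnSn i).
have IHw := IH psi1 admi (fun k ki => wH k (leqW ki)) (fun k ki => wH' k (leqW ki)) Ei.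
have pair_inj (f f' : GKl -> 'F_l) (p p' : GKl -> tower l i) :
    (fun s => (f s, p s)) = (fun s => (f' s, p' s)) -> f = f' /\ p = p'.
  move=> E; split; apply/funext => s.
    exact: (congr1 (fun F : GKl -> 'F_l * tower l i => (F s).1) E).
  exact: (congr1 (fun F : GKl -> 'F_l * tower l i => (F s).2) E).
case: (asboolP (~ H2_trivial (pullback theta psi1))) => // /contrapT triv.
case: (asboolP (~ H2_trivial (pullback theta psi2))) => // _.
case: (boolP (theta_zero theta i)) => i0.
  case: (asboolP (in_span theta w i)) => // _.
  case: (asboolP (in_span theta w' i)) => // _ [<-] [/esym/pair_inj[E1 E2]].
  move=> j; rewrite ltnS leq_eqVlt => /predU1P[->|ji]; first exact: descend_inj.
  apply: IHw ji; by rewrite Ei' E2.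
move=> [<-] [/esym/pair_inj[E1 E2]].
have hpsi := Epi_hom epi.
have [nc nd _] := normalized_cochainP l_pr B adm hpsi triv.
move: E1; rewrite -E2; set nu := normalized_cochain B theta psi1 in nc nd * => E1.
have fac w0 : H1 w0 -> factors_prol l (nu + w0).
  move=> H0; apply: (cobounds_factors_prol l_pr adm hpsi).
    by apply: (continuous_comp2 +%R nc); case: H0.
  by move=> s t; rewrite -nd !fctE H0.2; ring.
move=> j; rewrite ltnS leq_eqVlt => /predU1P[->|ji].
  apply: (addrI nu); apply/funext => s.
  by rewrite -[LHS](descendE s (fac _ wHi)) E1 descendE //; exact: fac.
apply: IHw ji; by rewrite Ei' E2.
Qed.

(** Given psi, composing with the projection to G_i gives psi_i, and the last
    coordinate of psi trivializes the pullback of theta_(i+1). In a nonsplit step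
    w_(i+1) is the difference between this coordinate and the normalized cochain. In
    a split step it is the coordinate itself, and it lies outside the span of the
    previous split characters because psi is onto. *)
Lemma Ptilde_surj i (psi : GKl -> tower l i) : admissible theta i ->
  Epi iota theta i psi ->
  exists2 w : nat -> GK -> 'F_l, forall j, H1 (w j) & Ptilde B theta w i = Some psi.
Proof.
elim: i psi => [|i IH] psi adm epi.
  exists (fun=> 0); first by move=> _; exact: H1_0.
  by congr Some; apply/funext => s; case: (psi s).
have admi := admissibleW (leqnSn i) adm.
have [hpsi2 [c1 M1]] := tower_hom_snd (Epi_hom epi).
have [_ _ psi_surj] := epi.
pose f s : 'F_l := (psi s).1; pose psi' s : tower l i := (psi s).2.
have epi' : Epi iota theta i psi'.
  split; [exact: hpsi2.1|exact: hpsi2.2|move=> g].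
  by have [s sg] := psi_surj (0, g); exists s; rewrite /psi' sg.
have Epsi : psi = (fun s => (f s, psi' s)).
  by apply/funext => s; rewrite /f /psi'; case: (psi s).
have [w wH Ew] := IH psi' admi epi'.
have triv : H2_trivial (pullback theta psi').
  exists (f \o @res l K iota); first exact: res_continuous.
  by move=> s t; rewrite /= resM /f M1 /pullback /psi'; ring.
have desc_res : descend (l := l) (f \o @res l K iota) = f.
  by apply/funext => s; rewrite /descend /= res_liftK.
have [W WH EW] : exists2 W, H1 W & forall w', (forall j, (j < i)%N -> w' j = w j) -> w' i = W ->
    Ptilde B theta w' i.+1 = Some psi.
  have [i0|i0] := boolP (theta_zero theta i).
    exists (f \o @res l K iota).
      split; first exact: res_continuous.
      by move=> s t; rewrite /= resM /f M1 (theta_zeroP i0) addr0.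
    move=> w' ww' Ewi /=; rewrite (Ptilde_ext ww') Ew i0.
    case: asboolP => // _; case: asboolP => [[a]|_]; last by rewrite Ewi desc_res Epsi.
    rewrite Ewi => Ef; exfalso.
    pose g0 := tower1 l i; have [_ coordP] := Ptilde_Epi admi (fun j _ => wH j) Ew.
    (* The image of psi would lie in the hyperplane where the last coordinate is
       the given combination of the previous ones; s0 is mapped outside it. *)
    have [s0 s0E] := psi_surj (1 + \sum_(j < i | theta_zero theta j) a j * Defs.coord j g0, g0).
    have : f s0 = \sum_(j < i | theta_zero theta j) a j * Defs.coord j (psi' s0).
      have := congr1 (fun F : GK -> 'F_l => F (Defs.lift s0)) Ef.
      rewrite /= res_liftK fct_sumE => ->; apply: eq_bigr => j j0 /=.
      by rewrite ww' // -coordP // res_liftK.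
    rewrite /f /psi' s0E /= => /eqP; rewrite -subr_eq0 addrK => /eqP.
    exact/eqP/oner_neq0.
  have [nc nd _] := normalized_cochainP l_pr B adm hpsi2 triv.
  rewrite -/psi' in nc nd; set nu := normalized_cochain B theta psi' in nc nd.
  exists (f \o @res l K iota - nu).
    split; first exact: (continuous_comp2 (fun a b => a - b) (res_continuous c1) nc).
    move=> s t; rewrite !fctE /= resM /f M1 -/(pullback theta psi' s t) -nd.
    by rewrite -/(f _); ring.
  move=> w' ww' Ewi /=; rewrite (Ptilde_ext ww') Ew (negPf i0).
  case: asboolP => // _; rewrite Ewi -/nu.
  have -> : nu + (f \o @res l K iota - nu) = f \o @res l K iota.
    by apply/funext => s; rewrite !fctE; ring.
  by rewrite desc_res Epsi.
exists (fun j => if j == i then W else w j).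
  by move=> j; case: eqP.
apply: EW; last by rewrite eqxx.
by move=> j ji; rewrite ltn_eqF.
Qed.

(** The first cocycle lives on the trivial group and vanishes at the identity, so it
    is zero, and the zero character lies in the empty span. *)
Lemma Ptilde0_None r : (0 < r)%N -> admissible theta r ->
  Ptilde B theta (fun=> 0) r = None.
Proof.
case: r => // r _ adm; elim: r adm => [|r IH] adm; last first.
  have := IH (admissibleW (leqnSn _) adm); move: r.+1 {IH adm} => n En.
  by rewrite /= En.
rewrite /=; case: asboolP => // _.
have [_ th _] := adm 0%N (ltn0Sn _).
have -> : theta_zero theta 0.
  by apply/forallP=> -[]; apply/forallP=> -[]; apply/eqP; exact: th.
case: asboolP => // -[]; exists (fun=> 0); by rewrite big_ord0.
Qed.

End PtildeTheory.

(** * The parametrization of epimorphisms *)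

Theorem proposition6p7 (l : nat) (l_prime : prime l)
    (K : fieldExtType rat) (iota : {rmorphism K -> algC})
    (D : forall q : finite_place K, local_data iota q)
    (B : generator_data l D)
    (r : nat) (r_gt0 : (0 < r)%N)
    (theta : forall i, tower l i -> tower l i -> 'F_l)
    (theta_adm : admissible theta r) :
  [/\ set_fun (Prim B r)
        (Some @` Epi iota theta r `|` [set None])
        (PG B theta r),
      set_surj (Prim B r)
        (Some @` Epi iota theta r `|` [set None])
        (PG B theta r)
    & set_bij (Prim_solv B theta r)
        (Some @` Epi iota theta r)
        (PG B theta r)].
Proof.
have onto : forall psi, Epi iota theta r psi -> exists2 v, Prim B r v & PG B theta r v = Some psi.
  move=> psi /(Ptilde_surj l_prime B theta_adm)[w wH Ew].
  have [v Pv vE] := Pow_surj l_prime B (fun j (_ : (j < r)%N) => wH j).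
  by exists v => //; rewrite /PG (Ptilde_ext _ _ vE).
split.
- move=> v Pv; case E : (PG B theta r v) => [psi|]; last by right.
  left; exists psi => //.
  by have [] := Ptilde_Epi l_prime theta_adm (fun j _ => Pow_H1 j Pv) E.
- move=> _ [[psi /onto[v Pv <-] <-]|->]; first by exists v.
  have [v Pv vE] := Pow_surj l_prime B (fun j (_ : (j < r)%N) => H1_0 iota l).
  exists v => //; rewrite /PG (Ptilde_ext _ _ vE).
  exact: Ptilde0_None.
split.
- by move=> v [_].
- move=> v v' /set_mem[Pv [psi epi Ev]] /set_mem[Pv' _] vv'.
  apply: (Pow_inj Pv Pv').
  by apply: (Ptilde_inj l_prime theta_adm (fun j _ => Pow_H1 j Pv)
    (fun j _ => Pow_H1 j Pv') (esym Ev)); rewrite -[LHS]vv' -Ev.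
- move=> _ [psi epi <-]; have [v Pv Ev] := onto psi epi.
  by exists v => //; split=> //=; rewrite Ev; exists psi.
Qed.
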